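(* Let $n\ge 2$ and let $\Phi:\mathbb{R}\to\mathbb{R}$ be a real analytic function, bounded below, with $\lim_{y\to+\infty}\Phi(y)=+\infty$. Assume $\Phi$ is generic, i.e. there is no $b\in\mathbb{R}$ and no function $h:\mathbb{R}\to\mathbb{R}$, even or odd, such that $\Phi''(t)=h(t-b)$ for all $t\in\mathbb{R}$. Put $\phi=\Phi'$, $q_0=q_n$, $q_{n+1}=q_1$, and consider on $\mathbb{R}^{2n}$ with coordinates $(q_1,\dots,q_n,p_1,\dots,p_n)$ the vector fields $$f=\sum_{k=1}^{n}p_k\frac{\partial}{\partial q_k}+\sum_{k=1}^{n}\bigl(\phi(q_{k-1}-q_k)-\phi(q_k-q_{k+1})\bigr)\frac{\partial}{\partial p_k},\qquad g=\frac{\partial}{\partial p_1}.$$ Then the pair $\{f,g\}$ is bracket generating at each point of $\mathbb{R}^{2n}$; therefore, for every $\tilde x\in\mathbb{R}^{2n}$, the orbit $\mathcal{O}_{\tilde x}$ through $\tilde x$ of the control-affine system $\dot x=f(x)+g(x)u$, $u\in\mathbb{R}$, coincides with $\mathbb{R}^{2n}$.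
   Context: A family $\mathcal{F}$ of vector fields on $\mathbb{R}^{2n}$ is called bracket generating at $x$ if the evaluations at $x$ of the vector fields in the Lie algebra $\mathrm{Lie}\{\mathcal{F}\}$ generated by $\mathcal{F}$ (under the Lie bracket of vector fields) fill all of $\mathbb{R}^{2n}$. For a vector field $X$, $e^{tX}$ denotes its flow. With $f^{u}=f+ug$ for constant $u\in\mathbb{R}$, the orbit $\mathcal{O}_{\tilde x}$ is the set of all points $\bigl(e^{t_1f^{u_1}}\circ\cdots\circ e^{t_Nf^{u_N}}\bigr)(\tilde x)$ with $N\in\mathbb{N}$, $u_1,\dots,u_N\in\mathbb{R}$ and $t_1,\dots,t_N\in\mathbb{R}$ (times of both signs allowed). *)

(* Defs.v *)
From HB Require Import structures.
From mathcomp Require Import all_boot all_order all_algebra.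
From mathcomp Require Import all_classical all_reals all_analysis.
Set Implicit Arguments.
Unset Strict Implicit.
Unset Printing Implicit Defensive.
Import Order.TTheory GRing.Theory Num.Theory.
Import numFieldNormedType.Exports.
Local Open Scope ring_scope.
Local Open Scope classical_set_scope.

Definition real_analytic (R : realType) (F : R -> R) : Prop :=
  forall a : R, exists c : nat -> R,
    \forall y \near a, pseries c (y - a) @ \oo --> F y.

Definition even_fun (R : realType) (h : R -> R) : Prop :=
  forall t, h (- t) = h t.

Definition odd_fun (R : realType) (h : R -> R) : Prop :=
  forall t, h (- t) = - h t.

Definition generic_potential (R : realType) (Phi : R -> R) : Prop :=
  ~ exists (b : R) (h : R -> R),
      (even_fun h \/ odd_fun h) /\ forall t, Phi^`(2) t = h (t - b).

(* A vector field on a normed space V is a map V -> V, and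
   [X, Y](x) = DY(x) X(x) - DX(x) Y(x). *)
Definition lie_bracket (R : realType) (V : normedModType R) (X Y : V -> V) :
    V -> V :=
  fun x => 'D_(X x) Y x - 'D_(Y x) X x.

Definition lie_closed (R : realType) (V : normedModType R)
    (S : set (V -> V)) : Prop :=
  [/\ S 0,
      forall (a : R) X Y, S X -> S Y -> S (a *: X + Y) &
      forall X Y, S X -> S Y -> S (lie_bracket X Y)].

(* The directional derivative is a total operator, so no smoothness side
   condition appears in lie_closed; when F consists of smooth vector fields,
   so does Lie F, by minimality. *)
Definition Lie (R : realType) (V : normedModType R) (F : set (V -> V)) :
    set (V -> V) :=
  smallest (@lie_closed R V) F.

Definition bracket_generating_at (R : realType) (V : normedModType R)
    (F : set (V -> V)) (x : V) : Prop :=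
  [set X x | X in Lie F] = [set: V].

(* flow X t x y is the relation y = e^{tX}(x): some integral curve of X, on an
   open interval containing 0 and t, goes from x at time 0 to y at time t. It is
   the graph of the usual, a priori only partially defined, flow map when
   integral curves are unique (e.g. for smooth X). The time t may be
   negative. *)
Definition flow (R : realType) (V : normedModType R) (X : V -> V)
    (t : R) (x y : V) : Prop :=
  exists (a b : R) (gamma : R -> V),
    [/\ 0 \in `]a, b[, t \in `]a, b[,
        forall s : R, s \in `]a, b[ ->
          is_derive s (1 : R) gamma (X (gamma s)),
        gamma 0 = x & gamma t = y].

(* For s = [:: (t_1, u_1); ...; (t_N, u_N)], the relation
   y = (e^{t_1 f^{u_1}} \o ... \o e^{t_N f^{u_N}})(x), with f^u = f + u g. *)
Fixpoint flow_comp (R : realType) (V : normedModType R) (f g : V -> V)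
    (s : seq (R * R)) (x y : V) : Prop :=
  if s is (t, u) :: s' then
    exists2 z, flow_comp f g s' x z & flow (f + u *: g) t z y
  else y = x.

Definition orbit_through (R : realType) (V : normedModType R) (f g : V -> V)
    (x : V) : set V :=
  [set y | exists s : seq (R * R), flow_comp f g s x y].

(* R^{2n} is 'rV[R]_(n + n), with points row_mx q p. Indices are shifted by one:
   q_k is the entry of q at the ordinal of value k - 1. ord_pred and ordS are
   the cyclic predecessor and successor on 'I_n, encoding q_0 = q_n and
   q_{n+1} = q_1. *)
Definition chain_drift (R : realType) (n : nat) (Phi : R -> R)
    (x : 'rV[R]_(n + n)) : 'rV[R]_(n + n) :=
  let q := lsubmx x in
  let p := rsubmx x in
  let phi := Phi^`() in
  row_mx p (\row_(k < n) (phi (q 0 (ord_pred k) - q 0 k)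
                          - phi (q 0 k - q 0 (ordS k)))).

Definition chain_control (R : realType) (n : nat)
    (x : 'rV[R]_(n + n)) : 'rV[R]_(n + n) :=
  row_mx 0 (\row_(k < n) (if val k == 0%N then 1 else 0)).

(* Main.v *)
(** Differentiating [f, d/dq_1] repeatedly in q_1 produces the fields
    Phi^(2+j)(q_1 - q_2) d/dp_2 + (-1)^j Phi^(2+j)(q_n - q_1) d/dp_n modulo d/dp_1.
    If all of them were proportional at some point, the identity theorem would
    give a linear relation between Phi''(c - s) and Phi''(d + s), forcing Phi'' to
    be even or odd about a point.  So d/dp_2 lies in the localized module generated
    by the Lie algebra, hence so does d/dq_2 = -[f, d/dp_2]; the other directions
    follow one site at a time, as some derivative of Phi'' is nonzero.

    For the orbits, call v steerable at x if there are maps th_t, moving points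
    inside their orbits, with th_t y - th_s z = y - z + (t - s) v up to a relative
    Lipschitz error as small as desired.  Conjugating th by the flow of f + u g for
    a fixed small time shows that steerable fields are stable under bracketing with
    f and g.  Only Lipschitz flows of the ODE are needed, not their differentiability
    in the initial point.  When all directions are steerable, a contraction argument
    shows that orbits are open, hence everything by connectedness. *)
Require Import Defs.
From HB Require Import structures.
From mathcomp Require Import all_boot all_order all_algebra.
From mathcomp Require Import all_classical all_reals all_analysis.
From mathcomp Require Import ring lra.
Import Order.TTheory GRing.Theory Num.Theory.
Import numFieldNormedType.Exports.
Set Implicit Arguments.
Unset Strict Implicit.
Unset Printing Implicit Defensive.
Local Open Scope ring_scope.
Local Open Scope classical_set_scope.


(** * Strict derivatives *)

Section StrictDerivative.
Context {R : realType}.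

(** Which derivative of the potential is nonzero varies from point to point, and a bracket needs
    fields on a neighbourhood, not just their values. Hence the function coefficients: a field
    counts as reached at a fixed point once some multiple of it, by a function not vanishing there,
    lies in the module over the Lie algebra. Brackets remain available, and at the point itself the
    multiplier is a nonzero scalar. In the steering part the delicate issue is the order of choices.
    A bracket appears as a difference quotient: a field transported during time tau, minus the field
    itself, divided by tau. The division amplifies every error by 1 / tau, so the transport has to
    be accurate up to q tau with q fixed beforehand. This is possible because the precision of a
    steerable field is arbitrary and can be prescribed after tau. Measuring errors on pairs of
    points is what lets such maps be composed, since the second map acts on points already displaced
    differently; it is also what the final contraction needs. *)

Lemma eq_is_derive {V W : normedModType R} (f g : V -> W) (x v : V) (l k : W) :
  f =1 g -> is_derive x v f l -> l = k -> is_derive x v g k.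
Proof. by move=> /funext <- ? <-. Qed.

Lemma mean_value_le (h h' : R -> R) (a b C u w : R) :
  (forall s, a < s < b -> is_derive s (1 : R) h (h' s)) ->
  (forall s, a < s < b -> `|h' s| <= C) ->
  a < u < b -> a < w < b -> `|h u - h w| <= C * `|u - w|.
Proof.
move=> dh bh.
wlog uw : u w / w <= u.
  move=> H hu hw; have [wu|uw] := leP w u; first exact: H.
  by rewrite distrC (distrC u); apply: H => //; exact: ltW.
move=> /andP[au ub] /andP[aw wb].
have insab s : w <= s <= u -> a < s < b.
  by move=> /andP[ws su]; rewrite (lt_le_trans aw ws) (le_lt_trans su ub).
have [||c] := @MVT_segment _ h h' w u uw.
- by move=> s; rewrite in_itv/= => /andP[/ltW ws /ltW su]; apply/dh/insab/andP.
- apply: derivable_within_continuous => s; rewrite in_itv/= => /insab/dh hs.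
  exact: ex_derive.
rewrite in_itv/= => /insab/bh hc ->; rewrite normrM.
by rewrite ler_wpM2r.
Qed.

Lemma strict_derivative (h h' : R -> R) (x e : R) :
  (forall s, is_derive s (1 : R) h (h' s)) -> {for x, continuous h'} -> 0 < e ->
  exists2 d, 0 < d & forall u w, `|u - x| < d -> `|w - x| < d ->
    `|h u - h w - h' x * (u - w)| <= e * `|u - w|.
Proof.
move=> dh ch e0.
have /cvgrPdist_le /(_ _ e0) := ch; rewrite near_simpl => /nbhs_ballP[d/= d0 hd].
exists d => // u w ux wx.
pose k s := h s - h' x * s.
have dk s : is_derive s (1 : R) k (h' s - h' x).
  apply: (@eq_is_derive _ _ (h - (h' x \*: id))) => //.
  by rewrite [_ *: _]mulr1.
have -> : h u - h w - h' x * (u - w) = k u - k w by rewrite /k; ring.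
apply: (@mean_value_le k (fun s => h' s - h' x) (x - d) (x + d)) => //.
- move=> s xsd; rewrite distrC; apply: hd.
  by rewrite /ball/= ltr_distlC.
- by rewrite -ltr_distl.
- by rewrite -ltr_distl.
Qed.

End StrictDerivative.

Section RowNorm.
Context {R : realType} {m : nat}.
Implicit Types (v : 'rV[R]_m) (C : R).

Lemma coord_le_norm v i : `|v 0 i| <= `|v|.
Proof.
rewrite [leRHS]/Num.Def.normr/= mx_normrE.
exact: (le_bigmax _ (fun ij => `|v ij.1 ij.2|) (0, i)).
Qed.

Lemma row_norm_le v C : 0 <= C -> (forall i, `|v 0 i| <= C) -> `|v| <= C.
Proof.
move=> C0 vC; rewrite /Num.Def.normr/= mx_normrE (bigmax_le _ C0)//= => -[i j] _.
by rewrite (ord1 i)/=.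
Qed.

End RowNorm.

Lemma mulmx_bounded {R : realType} m p (M : 'M[R]_(m, p)) :
  exists2 K, 0 < K & forall v : 'rV[R]_m, `|v *m M| <= K * `|v|.
Proof.
pose K := 1 + \sum_(j < p) \sum_(i < m) `|M i j|.
have K0 : 0 <= \sum_(j < p) \sum_(i < m) `|M i j|.
  by apply: sumr_ge0 => j _; exact: sumr_ge0.
exists K => [|v]; first by rewrite /K ltr_pwDl.
apply: row_norm_le => [|j]; first by rewrite mulr_ge0// /K; lra.
rewrite mxE; apply: (le_trans (ler_norm_sum _ _ _)).
apply: (@le_trans _ _ ((\sum_(i < m) `|M i j|) * `|v|)).
  rewrite mulr_suml; apply: ler_sum => i _.
  by rewrite normrM mulrC ler_wpM2l// coord_le_norm.
rewrite ler_wpM2r// /K (bigD1 j)//=.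
have : 0 <= \sum_(k < p | k != j) \sum_(i < m) `|M i k|.
  by apply: sumr_ge0 => k _; exact: sumr_ge0.
lra.
Qed.

(* Strict differentiability with gradient [l]; unlike differentiability at a
   point, it yields local Lipschitz estimates directly. *)
Definition sdiff {R : realType} {m p : nat} (a : 'rV[R]_m -> 'rV[R]_p) x
    (l : 'M[R]_(m, p)) :=
  forall e, 0 < e -> exists2 d, 0 < d & forall y z,
    `|y - x| < d -> `|z - x| < d ->
    `|a y - a z - (y - z) *m l| <= e * `|y - z|.

Section StrictGradient.
Context {R : realType} {m : nat}.
Implicit Types (a b : 'rV[R]_m -> R) (x y z : 'rV[R]_m) (l : 'cV[R]_m).

Definition sgrad a x l := forall e, 0 < e -> exists2 d, 0 < d & forall y z,
  `|y - x| < d -> `|z - x| < d ->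
  `|a y - a z - ((y - z) *m l) 0 0| <= e * `|y - z|.

Lemma sgrad_is_derive a x l v :
  sgrad a x l -> is_derive x v a ((v *m l) 0 0).
Proof.
move=> al.
have H : (fun h : R => h^-1 *: ((a \o shift x) (h *: v) - a x)) @ 0^' -->
    ((v *m l) 0 0 : R).
  apply/cvgrPdist_le => /= e e0.
  have e1 : 0 < e / (1 + `|v|) by rewrite divr_gt0// ltr_pwDl.
  have [d d0 ad] := al _ e1.
  near=> h.
  have h0 : h != 0 by near: h; exact: nbhs_dnbhs_neq.
  have hd : `|h| < d / (1 + `|v|).
    by near: h; apply: dnbhs0_lt; rewrite divr_gt0// ltr_pwDl.
  have hv : `|h *: v + x - x| < d.
    rewrite addrK normrZ; move: hd; rewrite ltr_pdivlMr ?ltr_pwDl//.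
    by apply: le_lt_trans; rewrite ler_wpM2l// lerDr.
  have := ad (h *: v + x) x hv.
  rewrite subrr normr0 => /(_ d0); rewrite addrK normrZ -scalemxAl mxE.
  rewrite /=; set A := a _ - a x; set L := (v *m l) 0 0; move: A L => A L HA.
  have -> : L - h^-1 * A = - (h^-1 * (A - h * L)).
    by rewrite mulrBr mulKf// opprB.
  rewrite normrN normrM normfV ler_pdivrMl ?normr_gt0//.
  apply: (le_trans HA); rewrite mulrCA ler_wpM2l//.
  by rewrite mulrAC ler_pdivrMr ?ltr_pwDl// ler_pM2l// lerDr.
by split; [apply/cvg_ex; exists ((v *m l) 0 0)|exact: cvg_lim].
Unshelve. all: by end_near. Qed.

Lemma sgrad_cst c x : sgrad (fun=> c) x 0.
Proof.
by move=> e e0; exists 1 => // y z _ _; rewrite mulmx0 mxE !subr0 subrr normr0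
  mulr_ge0// ltW.
Qed.

Lemma sgrad_coord i x : sgrad (fun y => y 0 i) x (delta_mx i 0).
Proof.
move=> e e0; exists 1 => // y z _ _; rewrite -colE !mxE subrr normr0.
by rewrite mulr_ge0// ltW.
Qed.

Lemma sgrad_add a b x l k :
  sgrad a x l -> sgrad b x k -> sgrad (fun y => a y + b y) x (l + k).
Proof.
move=> al bk e e0.
have [d1 d10 ad] := al _ (divr_gt0 e0 (ltr0Sn _ 1)).
have [d2 d20 bd] := bk _ (divr_gt0 e0 (ltr0Sn _ 1)).
exists (Num.min d1 d2) => [|y z]; first by rewrite lt_min d10.
rewrite !lt_min => /andP[y1 y2] /andP[z1 z2].
rewrite mulmxDr mxE.
have -> : a y + b y - (a z + b z) - (((y - z) *m l) 0 0 + ((y - z) *m k) 0 0)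
  = (a y - a z - ((y - z) *m l) 0 0) + (b y - b z - ((y - z) *m k) 0 0) by ring.
rewrite (le_trans (ler_normD _ _))// (splitr e) mulrDl.
by rewrite lerD// ?ad ?bd.
Qed.

Lemma sgrad_lipschitz a x l : sgrad a x l ->
  exists2 K, 0 < K & exists2 d, 0 < d & forall y z,
    `|y - x| < d -> `|z - x| < d -> `|a y - a z| <= K * `|y - z|.
Proof.
move=> al; have [K K0 lK] := mulmx_bounded l.
exists (1 + K); first by lra.
have [d d0 ad] := al _ ltr01; exists d => // y z yd zd.
rewrite -(subrK (((y - z) *m l) 0 0) (a y - a z)) (le_trans (ler_normD _ _))//.
rewrite mulrDl lerD// ?ad//; apply: le_trans (lK _); exact: coord_le_norm.
Qed.

Lemma sgrad_mul a b x l k : sgrad a x l -> sgrad b x k ->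
  sgrad (fun y => a y * b y) x (a x *: k + b x *: l).
Proof.
move=> al bk e e0.
have [Ka Ka0 [da da0 aK]] := sgrad_lipschitz al.
have [Kb Kb0 [db db0 bK]] := sgrad_lipschitz bk.
pose M := 1 + `|a x| + `|b x| + 2 * Ka * Kb.
have M0 : 0 < M by rewrite /M; have := normr_ge0 (a x); have := normr_ge0 (b x);
  have := mulr_gt0 Ka0 Kb0; lra.
have [q q0 qM] : exists2 q, 0 < q & q * M <= e.
  by exists (e / M); rewrite ?divr_gt0// divfK ?gt_eqF.
have [d1 d10 ad] := al _ q0.
have [d2 d20 bd] := bk _ q0.
pose d := Num.min (Num.min q (Num.min d1 d2)) (Num.min da db).
exists d => [|y z]; first by rewrite !lt_min q0 d10 d20 da0.
rewrite !lt_min => /andP[/andP[yq /andP[y1 y2]] /andP[ya yb]].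
move=> /andP[/andP[zq /andP[z1 z2]] /andP[za zb]].
rewrite mulmxDr mxE -!scalemxAr ![(_ *: (_ *m _)) 0 0]mxE.
have {}ad := ad y z y1 z1; have {}bd := bd y z y2 z2.
have byx : `|b y - b x| <= Kb * q.
  have := bK y x yb; rewrite subrr normr0 => /(_ db0) /le_trans; apply.
  by rewrite ler_wpM2l// ltW.
have azx : `|a z - a x| <= Ka * q.
  have := aK z x za; rewrite subrr normr0 => /(_ da0) /le_trans; apply.
  by rewrite ler_wpM2l// ltW.
have ayz := aK y z ya za; have byz := bK y z yb zb.
move: ((_ *m l) _ _) ((_ *m k) _ _) ad bd => L K.
set A := a y - a z in ayz *; set B := b y - b z in byz *; move=> ad bd.
set n := `|y - z| in ayz byz ad bd *.
have n0 : 0 <= n by exact: normr_ge0.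
(* The first two products pair an increment with a deviation from the base point, of size O([q])
   since the radius is at most [q]; the other two are the errors of the factors. [M] collects all
   the constants. *)
have -> : a y * b y - a z * b z - (a x * K + b x * L) =
   (A * (b y - b x) + B * (a z - a x)) + (a x * (B - K) + b x * (A - L)).
  by rewrite /A /B; ring.
rewrite (le_trans (ler_normD _ _))//.
have h1 : `|A * (b y - b x) + B * (a z - a x)| <= 2 * Ka * Kb * q * n.
  rewrite (le_trans (ler_normD _ _))// !normrM.
  have := ler_pM (normr_ge0 _) (normr_ge0 _) ayz byx.
  have := ler_pM (normr_ge0 _) (normr_ge0 _) byz azx.
  lra.
have h2 : `|a x * (B - K) + b x * (A - L)| <= (`|a x| + `|b x|) * q * n.
  rewrite (le_trans (ler_normD _ _))// !normrM.
  have := ler_wpM2l (normr_ge0 (a x)) bd.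
  have := ler_wpM2l (normr_ge0 (b x)) ad.
  lra.
have := ler_wpM2r n0 qM; have := mulr_ge0 (ltW q0) n0.
rewrite /M; lra.
Qed.

End StrictGradient.

(** * Smooth vector fields *)

Section SmoothFunctions.
Context {R : realType} {m : nat} (F : nat -> R -> R).
Hypothesis dF : forall k y, is_derive y (1 : R) (F k) (F k.+1 y).
Notation V := 'rV[R]_m.
Implicit Types (a b : V -> R) (X Y Z : V -> V) (x v : V).

(** [F k] stands for the k-th derivative of the potential. The algebra generated by coordinates and
    gap functions contains all components of iterated brackets of drift and control, and derivation
    identities on it can be proved by induction on generators. *)
Inductive smooth : (V -> R) -> Prop :=
| smooth_cst c : smooth (fun=> c)
| smooth_coord i : smooth (fun x => x 0 i)
| smooth_gap k i j : smooth (fun x => F k (x 0 i - x 0 j))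
| smooth_add a b : smooth a -> smooth b -> smooth (fun x => a x + b x)
| smooth_mul a b : smooth a -> smooth b -> smooth (fun x => a x * b x).

Lemma smooth_scale c a : smooth a -> smooth (fun x => c * a x).
Proof. by move=> sa; apply: smooth_mul => //; exact: smooth_cst. Qed.

Lemma smooth_sub a b : smooth a -> smooth b -> smooth (fun x => a x - b x).
Proof.
move=> sa sb; rewrite (_ : (fun x => _) = (fun x => a x + (-1) * b x)).
  by apply: smooth_add => //; exact: smooth_scale.
by apply/funext => x; rewrite mulN1r.
Qed.

Lemma sgrad_gap k i j x : sgrad (fun y => F k (y 0 i - y 0 j)) x
  (F k.+1 (x 0 i - x 0 j) *: (delta_mx i 0 - delta_mx j 0)).
Proof.
move=> e e0; have e2 : 0 < e / 2 by lra.
have cF : {for (x 0 i - x 0 j), continuous (F k.+1)}.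
  by have := dF k.+1 (x 0 i - x 0 j) => ?;
    apply/differentiable_continuous/derivable1_diffP.
have [d d0 dk] := strict_derivative (dF k) cF e2.
exists (d / 2) => [|y z yd zd]; first by lra.
have coordB w : `|w - x| < d / 2 -> `|w 0 i - w 0 j - (x 0 i - x 0 j)| < d.
  move=> wd; have := coord_le_norm (w - x) i; have := coord_le_norm (w - x) j.
  rewrite !mxE => hj hi.
  rewrite (_ : _ - _ = (w 0 i - x 0 i) - (w 0 j - x 0 j)); last by ring.
  by rewrite (le_lt_trans (ler_normB _ _))//; lra.
have := dk _ _ (coordB _ yd) (coordB _ zd).
rewrite -scalemxAr mulmxBr -!colE !mxE.
have -> : y 0 i - y 0 j - (z 0 i - z 0 j) = (y 0 i - z 0 i) - (y 0 j - z 0 j).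
  by ring.
move=> /le_trans; apply; rewrite -mulrA ler_pM2l//.
have := coord_le_norm (y - z) i; have := coord_le_norm (y - z) j.
by rewrite !mxE => hj hi; rewrite ler_pdivrMl// (le_trans (ler_normB _ _))//; lra.
Qed.

Lemma smooth_sgrad a x : smooth a -> exists l, sgrad a x l.
Proof.
elim=> {a} [c|i|k i j|a b _ [l al] _ [k bk]|a b _ [l al] _ [k bk]].
- by exists 0; exact: sgrad_cst.
- by exists (delta_mx i 0); exact: sgrad_coord.
- by eexists; exact: sgrad_gap.
- by eexists; apply: sgrad_add; eassumption.
- by eexists; apply: sgrad_mul; eassumption.
Qed.

Lemma smooth_derivable a x v : smooth a -> derivable a x v.
Proof. by move=> /(smooth_sgrad x)[l al]; have [] := sgrad_is_derive v al. Qed.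

Lemma sgrad_derive a x l v : sgrad a x l -> 'D_v a x = (v *m l) 0 0.
Proof. by move=> al; have [] := sgrad_is_derive v al. Qed.

Definition sfield X := forall i, smooth (fun x => X x 0 i).

Definition der X a := fun x => 'D_(X x) a x.

Lemma der_cst X c : der X (fun=> c) = fun=> 0.
Proof. by apply/funext => x; rewrite /der derive_cst. Qed.

Lemma der_coord X i : der X (fun x => x 0 i) = fun x => X x 0 i.
Proof.
apply/funext => x; rewrite /der.
by rewrite (sgrad_derive _ (sgrad_coord i x)) -colE mxE.
Qed.

Lemma der_gap X k i j : der X (fun x => F k (x 0 i - x 0 j)) =
  fun x => F k.+1 (x 0 i - x 0 j) * (X x 0 i - X x 0 j).
Proof.
apply/funext => x; rewrite /der.
by rewrite (sgrad_derive _ (sgrad_gap k i j x)) -scalemxAr mulmxBr -!colE !mxE.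
Qed.

Lemma der_add X a b : smooth a -> smooth b ->
  der X (fun x => a x + b x) = fun x => der X a x + der X b x.
Proof.
move=> sa sb; apply/funext => x.
by rewrite /der (deriveD (smooth_derivable sa) (smooth_derivable sb)).
Qed.

Lemma der_mul X a b : smooth a -> smooth b ->
  der X (fun x => a x * b x) = fun x => a x * der X b x + b x * der X a x.
Proof.
move=> sa sb; apply/funext => x.
by rewrite /der (deriveM (smooth_derivable sa) (smooth_derivable sb)).
Qed.

Lemma der_sub X a b : smooth a -> smooth b ->
  der X (fun x => a x - b x) = fun x => der X a x - der X b x.
Proof.
move=> sa sb; apply/funext => x.
by rewrite /der (deriveB (smooth_derivable sa) (smooth_derivable sb)).
Qed.

Lemma smooth_der X a : sfield X -> smooth a -> smooth (der X a).
Proof.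
move=> sX; elim=> {a} [c|i|k i j|a b sa iha sb ihb|a b sa iha sb ihb].
- by rewrite der_cst; exact: smooth_cst.
- by rewrite der_coord; exact: sX.
- rewrite der_gap; apply: smooth_mul; first exact: smooth_gap.
  exact: smooth_sub.
- by rewrite der_add//; exact: smooth_add.
- by rewrite der_mul//; apply: smooth_add; exact: smooth_mul.
Qed.

Lemma der_addl X Y a x : smooth a -> der (X + Y) a x = der X a x + der Y a x.
Proof.
move=> /(smooth_sgrad x)[l al]; rewrite /der.
by rewrite !(sgrad_derive _ al) mulmxDl mxE.
Qed.

Lemma der_scalel X a b x : smooth a ->
  der (fun y => b y *: X y) a x = b x * der X a x.
Proof.
move=> /(smooth_sgrad x)[l al]; rewrite /der.
by rewrite !(sgrad_derive _ al) -scalemxAl mxE.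
Qed.

Lemma sfield_derivable X x v : sfield X -> derivable X x v.
Proof.
by move=> sX; apply/derivable_mxP => i j; rewrite (ord1 i); exact: smooth_derivable.
Qed.

Lemma lie_bracketE X Y i : sfield X -> sfield Y ->
  (fun x => lie_bracket X Y x 0 i) =
  fun x => der X (fun y => Y y 0 i) x - der Y (fun y => X y 0 i) x.
Proof.
move=> sX sY; apply/funext => x; rewrite /lie_bracket /der !mxE.
by rewrite !derive_mx ?mxE//; exact: sfield_derivable.
Qed.

Lemma sfield_bracket X Y : sfield X -> sfield Y -> sfield (lie_bracket X Y).
Proof.
by move=> sX sY i; rewrite lie_bracketE//; apply: smooth_sub; exact: smooth_der.
Qed.

Lemma sfield_add X Y : sfield X -> sfield Y -> sfield (X + Y).
Proof.
move=> sX sY i; rewrite (_ : (fun x => _) = (fun x => X x 0 i + Y x 0 i)).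
  exact: smooth_add.
by apply/funext => x; rewrite !mxE.
Qed.

Lemma sfield_scale a X : smooth a -> sfield X -> sfield (fun x => a x *: X x).
Proof.
move=> sa sX i; rewrite (_ : (fun x => _) = (fun x => a x * X x 0 i)).
  exact: smooth_mul.
by apply/funext => x; rewrite !mxE.
Qed.

Lemma eq_field X Y : (forall i, (fun x => X x 0 i) = fun x => Y x 0 i) -> X = Y.
Proof.
move=> XY; apply/funext => x; apply/rowP => i.
exact: (congr1 (fun a => a x) (XY i)).
Qed.

Lemma sub_coord X Y x i : (X - Y) x 0 i = X x 0 i - Y x 0 i.
Proof. by rewrite !mxE. Qed.

(* Both sides are derivations of the algebra of smooth functions, so it is
   enough to compare them on the generators. *)
Lemma der_bracket X Y a : sfield X -> sfield Y -> smooth a ->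
  der (lie_bracket X Y) a = fun x => der X (der Y a) x - der Y (der X a) x.
Proof.
move=> sX sY; elim=> {a} [c|i|k i j|a b sa iha sb ihb|a b sa iha sb ihb].
- by rewrite !der_cst; apply/funext => x; rewrite subrr.
- by rewrite !der_coord lie_bracketE.
- rewrite !der_gap.
  have sk n : smooth (fun x => F n (x 0 i - x 0 j)) by exact: smooth_gap.
  have sd Z : sfield Z -> smooth (fun x => Z x 0 i - Z x 0 j).
    by move=> sZ; exact: smooth_sub.
  rewrite (der_mul _ (sk _) (sd _ sX)) (der_mul _ (sk _) (sd _ sY)) !der_gap.
  rewrite !der_sub//.
  apply/funext => x; have E n := congr1 (fun a => a x) (lie_bracketE n sX sY).
  by rewrite /= in E; rewrite !E; ring.
- have sXa := smooth_der sX sa; have sXb := smooth_der sX sb.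
  have sYa := smooth_der sY sa; have sYb := smooth_der sY sb.
  rewrite !(der_add _ sa sb) (der_add _ sYa sYb) (der_add _ sXa sXb) iha ihb.
  apply/funext => x /=.
  move: (der X (der Y a) x) (der X (der Y b) x) (der Y (der X a) x) => ? ? ?.
  by move: (der Y (der X b) x) => ?; ring.
- have sXa := smooth_der sX sa; have sXb := smooth_der sX sb.
  have sYa := smooth_der sY sa; have sYb := smooth_der sY sb.
  rewrite !(der_mul _ sa sb) iha ihb.
  rewrite (der_add _ (smooth_mul sa sYb) (smooth_mul sb sYa)).
  rewrite (der_add _ (smooth_mul sa sXb) (smooth_mul sb sXa)).
  rewrite (der_mul _ sa sYb) (der_mul _ sb sYa) (der_mul _ sa sXb) (der_mul _ sb sXa).
  apply/funext => x /=.
  move: (der X (der Y a) x) (der X (der Y b) x) (der Y (der X a) x) => ? ? ?.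
  move: (der Y (der X b) x) (der X a x) (der Y a x) => ? ? ?.
  by move: (der X b x) (der Y b x) => ? ?; ring.
Qed.

Lemma lie_bracket_bracketl X Y Z x i : sfield X -> sfield Y -> sfield Z ->
  lie_bracket (lie_bracket X Y) Z x 0 i =
  der X (der Y (fun y => Z y 0 i)) x - der Y (der X (fun y => Z y 0 i)) x -
  (der Z (der X (fun y => Y y 0 i)) x - der Z (der Y (fun y => X y 0 i)) x).
Proof.
move=> sX sY sZ; have sXY := sfield_bracket sX sY.
rewrite [LHS](congr1 (@^~ x) (lie_bracketE i sXY sZ)) lie_bracketE//.
by rewrite (der_bracket sX sY (sZ i)) (der_sub Z (smooth_der sX (sY i))
  (smooth_der sY (sX i))).
Qed.

Lemma lie_bracket_bracketr X Y Z x i : sfield X -> sfield Y -> sfield Z ->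
  lie_bracket X (lie_bracket Y Z) x 0 i =
  der X (der Y (fun y => Z y 0 i)) x - der X (der Z (fun y => Y y 0 i)) x -
  (der Y (der Z (fun y => X y 0 i)) x - der Z (der Y (fun y => X y 0 i)) x).
Proof.
move=> sX sY sZ; have sYZ := sfield_bracket sY sZ.
rewrite [LHS](congr1 (@^~ x) (lie_bracketE i sX sYZ)) lie_bracketE//.
by rewrite (der_bracket sY sZ (sX i)) (der_sub X (smooth_der sY (sZ i))
  (smooth_der sZ (sY i))).
Qed.

(** By [der_bracket], each component of a double bracket is a combination of second-order
    derivatives of the components of [X], [Y], [Z]; the identity is then linear in these terms. *)
Lemma jacobi X Y Z : sfield X -> sfield Y -> sfield Z ->
  lie_bracket (lie_bracket X Y) Z =
  lie_bracket X (lie_bracket Y Z) - lie_bracket Y (lie_bracket X Z).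
Proof.
move=> sX sY sZ; apply: eq_field => i; apply/funext => x.
rewrite [RHS]sub_coord [LHS](lie_bracket_bracketl x i sX sY sZ).
rewrite [X in _ = X - _](lie_bracket_bracketr x i sX sY sZ).
rewrite [X in _ = _ - X](lie_bracket_bracketr x i sY sX sZ).
move: (der X (der Y _) x) (der Y (der X _) x) (der Z (der X _) x) => ? ? ?.
move: (der Z (der Y _) x) (der X (der Z _) x) (der Y (der Z _) x) => ? ? ?.
by ring.
Qed.

End SmoothFunctions.

(** * Function coefficients and localization for a Lie algebra of fields *)

Section LieModule.
Context {R : realType} {m : nat} (F : nat -> R -> R).
Hypothesis dF : forall k y, is_derive y (1 : R) (F k) (F k.+1 y).
Notation V := 'rV[R]_m.
Implicit Types (a b c : V -> R) (X Y Z : V -> V) (x v : V).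
Let smooth := @smooth R m F.
Let sfield := @sfield R m F.

Lemma lie_bracket_scaler a X Y : smooth a -> sfield X -> sfield Y ->
  lie_bracket X (fun x => a x *: Y x) =
  (fun x => a x *: lie_bracket X Y x) + (fun x => der X a x *: Y x).
Proof.
move=> sa sX sY; have saY := sfield_scale sa sY.
apply: eq_field => i; apply/funext => x.
rewrite [LHS](congr1 (@^~ x) (lie_bracketE dF i sX saY)) /=.
have -> : (fun y => (a y *: Y y) 0 i) = fun y => a y * Y y 0 i.
  by apply/funext => y; rewrite mxE.
rewrite (der_mul dF X sa (sY i)) (der_scalel dF Y a x (sX i)).
rewrite [RHS]mxE [X in _ = X + _]mxE [X in _ = _ + X]mxE.
rewrite [lie_bracket X Y x 0 i](congr1 (@^~ x) (lie_bracketE dF i sX sY)).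
move: (der X _ x) (der Y _ x) (der X a x) => ? ? ?.
by ring.
Qed.

Lemma lie_bracketC X Y : lie_bracket Y X = - lie_bracket X Y.
Proof. by apply/funext => x; rewrite /lie_bracket fctE opprB. Qed.

Lemma lie_bracket_scalel a X Y : smooth a -> sfield X -> sfield Y ->
  lie_bracket (fun x => a x *: X x) Y =
  (fun x => a x *: lie_bracket X Y x) - (fun x => der Y a x *: X x).
Proof.
move=> sa sX sY; rewrite lie_bracketC lie_bracket_scaler// (lie_bracketC X Y).
apply/funext => x; rewrite !fctE opprD; congr (_ + _).
by rewrite -scalerN opprK.
Qed.

Lemma lie_bracket_addr X Y Z : sfield X -> sfield Y -> sfield Z ->
  lie_bracket X (Y + Z) = lie_bracket X Y + lie_bracket X Z.
Proof.
move=> sX sY sZ; have sYZ := sfield_add sY sZ.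
apply: eq_field => i; apply/funext => x.
rewrite [LHS](congr1 (@^~ x) (lie_bracketE dF i sX sYZ)) /=.
have -> : (fun y => (Y + Z) y 0 i) = fun y => Y y 0 i + Z y 0 i.
  by apply/funext => y; rewrite mxE.
rewrite (der_add dF X (sY i) (sZ i)) (der_addl dF Y Z x (sX i)) [RHS]mxE.
rewrite [X in _ = X + _](congr1 (@^~ x) (lie_bracketE dF i sX sY)).
rewrite [X in _ = _ + X](congr1 (@^~ x) (lie_bracketE dF i sX sZ)).
rewrite /=.
move: (der X _ x) (der X _ x) (der Y _ x) (der Z _ x) => ? ? ? ?.
by ring.
Qed.

Lemma lie_bracket_addl X Y Z : sfield X -> sfield Y -> sfield Z ->
  lie_bracket (X + Y) Z = lie_bracket X Z + lie_bracket Y Z.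
Proof.
move=> sX sY sZ; rewrite lie_bracketC lie_bracket_addr// opprD.
by congr (_ + _); exact/esym/lie_bracketC.
Qed.

Inductive lie_module (L : set (V -> V)) : (V -> V) -> Prop :=
| lie_module_base X : L X -> lie_module L X
| lie_module_add X Y : lie_module L X -> lie_module L Y -> lie_module L (X + Y)
| lie_module_scale a X :
    smooth a -> lie_module L X -> lie_module L (fun x => a x *: X x).

Context {L : set (V -> V)}.
Hypothesis L_closed : lie_closed L.
Hypothesis L_smooth : forall X, L X -> sfield X.

Lemma lie_module_sfield X : lie_module L X -> sfield X.
Proof.
elim=> {X} [X /L_smooth//|X Y _ sX _ sY|a X sa _ sX]; first exact: sfield_add.
exact: sfield_scale.
Qed.

Lemma lie_module_sub X Y :
  lie_module L X -> lie_module L Y -> lie_module L (X - Y).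
Proof.
move=> LX LY; rewrite (_ : - Y = fun x => (-1) *: Y x).
  apply: lie_module_add => //; apply: lie_module_scale => //.
  exact: smooth_cst.
by apply/funext => x; rewrite scaleN1r.
Qed.

(** Leibniz rule: the extra terms produced by the coefficients are again function multiples of the
    two fields. *)
Lemma lie_module_bracket X Y :
  lie_module L X -> lie_module L Y -> lie_module L (lie_bracket X Y).
Proof.
move=> LX; elim: LX Y => {X} [X LX|X X' LX HX LX' HX'|a X sa LX HX] Y LY.
- have sX := L_smooth LX.
  elim: LY => {Y} [Y LY|Y Y' LY HY LY' HY'|a Y sa LY HY].
  + by case: L_closed => _ _ H; apply/lie_module_base/H.
  + by rewrite lie_bracket_addr//; try exact: lie_module_sfield;
      exact: lie_module_add.
  + have sY := lie_module_sfield LY.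
    rewrite lie_bracket_scaler//; apply: lie_module_add.
      exact: lie_module_scale.
    by apply: lie_module_scale => //; exact: smooth_der.
- rewrite lie_bracket_addl//; try exact: lie_module_sfield.
  by apply: lie_module_add; [exact: HX|exact: HX'].
- have sX := lie_module_sfield LX; have sY := lie_module_sfield LY.
  rewrite lie_bracket_scalel//; apply: lie_module_sub.
    by apply: lie_module_scale => //; exact: HX.
  by apply: lie_module_scale => //; exact: smooth_der.
Qed.

(** At a single point function coefficients become scalars, so passing to the module does not
    enlarge the set of values. *)
Lemma lie_module_eval X x : lie_module L X -> [set Y x | Y in L] (X x).
Proof.
have [L0 LD _] := L_closed.
elim=> {X} [X LX|X Y _ [X' LX' EX] _ [Y' LY' EY]|a X _ _ [X' LX' EX]].
- by exists X.
- by exists (1 *: X' + Y'); [exact: LD|rewrite !fctE scale1r EX EY].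
- by exists (a x *: X' + 0); [exact: LD|rewrite !fctE addr0 EX].
Qed.

(* Localizing at [x0] allows division by functions that do not vanish there. *)
Definition lie_local x0 X := sfield X /\
  exists c, [/\ smooth c, c x0 != 0 & lie_module L (fun x => c x *: X x)].

Context {x0 : V}.

Lemma lie_local_base X : L X -> lie_local x0 X.
Proof.
move=> LX; split; first exact: L_smooth.
exists (fun=> 1); split; [exact: smooth_cst|exact: oner_neq0|].
by apply: lie_module_scale; [exact: smooth_cst|exact: lie_module_base].
Qed.

Lemma lie_local_div c X : smooth c -> c x0 != 0 -> sfield X ->
  lie_local x0 (fun x => c x *: X x) -> lie_local x0 X.
Proof.
move=> sc c0 sX [_ [d [sd d0 Ld]]]; split => //.
exists (fun x => d x * c x); split; first exact: smooth_mul.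
  by rewrite mulf_neq0.
by under eq_fun do rewrite -scalerA.
Qed.

Lemma lie_local_scale a X : smooth a -> lie_local x0 X ->
  lie_local x0 (fun x => a x *: X x).
Proof.
move=> sa [sX [c [sc c0 Lc]]]; split; first exact: sfield_scale.
exists c; split => //.
rewrite (_ : (fun x => _) = (fun x => a x *: (c x *: X x))).
  exact: lie_module_scale.
by apply/funext => x; rewrite !scalerA mulrC.
Qed.

Lemma lie_local_add X Y : lie_local x0 X -> lie_local x0 Y ->
  lie_local x0 (X + Y).
Proof.
move=> [sX [c [sc c0 Lc]]] [sY [d [sd d0 Ld]]]; split; first exact: sfield_add.
exists (fun x => c x * d x); split; [exact: smooth_mul|by rewrite mulf_neq0|].
rewrite (_ : (fun x => _) =
  (fun x => d x *: (c x *: X x)) + (fun x => c x *: (d x *: Y x))).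
  by apply: lie_module_add; exact: lie_module_scale.
by apply/funext => x; rewrite !fctE scalerDr !scalerA (mulrC (d x)).
Qed.

Lemma lie_local_sub X Y : lie_local x0 X -> lie_local x0 Y ->
  lie_local x0 (X - Y).
Proof.
move=> LX LY; rewrite (_ : - Y = fun x => (-1) *: Y x).
  by apply: lie_local_add => //; apply: lie_local_scale => //; exact: smooth_cst.
by apply/funext => x; rewrite scaleN1r.
Qed.

Lemma lie_local_bracket X Y : lie_local x0 X -> lie_local x0 Y ->
  lie_local x0 (lie_bracket X Y).
Proof.
move=> [sX [c [sc c0 Lc]]] [sY [d [sd d0 Ld]]].
have sXY : sfield (lie_bracket X Y) by exact: sfield_bracket.
split => //.
have scX : sfield (fun x => c x *: X x) by exact: sfield_scale.
have sdY : sfield (fun x => d x *: Y x) by exact: sfield_scale.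
exists (fun x => (c x * d x) * (c x * d x)); split.
- by do 2!apply: smooth_mul => //; exact: smooth_mul.
- by rewrite !mulf_neq0.
- have sYc : smooth (der Y c) by exact: smooth_der.
  have sXd : smooth (der X d) by exact: smooth_der.
  (* Leibniz gives [cX, dY] = cd [X,Y] + c (Xd) Y - d (Yc) X. A further factor cd turns the stray
     [Y] and [X] into multiples of dY and cX, which are in the module. *)
  pose E1 x := (c x * d x) *: lie_bracket (fun y => c y *: X y) (fun y => d y *: Y y) x.
  pose E2 x := (c x * der X d x * c x) *: (d x *: Y x).
  pose E3 x := (d x * der Y c x * d x) *: (c x *: X x).
  rewrite (_ : (fun x => _) = E1 - E2 + E3).
    apply: lie_module_add; first apply: lie_module_sub.
    + by apply: lie_module_scale; [exact: smooth_mul|exact: lie_module_bracket].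
    + by apply: lie_module_scale => //; do 2!apply: smooth_mul => //.
    + by apply: lie_module_scale => //; do 2!apply: smooth_mul => //.
  apply/funext => x; rewrite /E1 /E2 /E3.
  rewrite lie_bracket_scaler// lie_bracket_scalel//.
  rewrite (_ : der (fun y => c y *: X y) d = fun y => c y * der X d y); last first.
    by apply/funext => y; rewrite (der_scalel dF).
  rewrite !fctE.
  move: (lie_bracket X Y x) (der X d x) (der Y c x) => B p q.
  apply/rowP => i; rewrite !mxE; ring.
Qed.

Lemma lie_local_eval X : lie_local x0 X -> [set Y x0 | Y in L] (X x0).
Proof.
move=> [sX [c [sc c0 /(lie_module_eval x0)[Y LY Yx]]]].
have [L0 LD _] := L_closed.
exists ((c x0)^-1 *: Y + 0); first exact: LD.
by rewrite !fctE Yx addr0 scalerA mulVf// scale1r.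
Qed.

End LieModule.

(** * Analytic potentials *)

Section PowerSeries.
Context {R : realType}.
Implicit Types (c d : nat -> R) (H : R -> R) (a x y z r : R).

(** Dominates the terms of the differentiated series at [z] by those of the original series at a
    larger radius [r], up to the factor 1 / (r - z). *)
Lemma natrX_gap_le k z r : 0 <= z -> z <= r ->
  k.+1%:R * z ^+ k * (r - z) <= r ^+ k.+1.
Proof.
move=> z0 zr; elim: k => [|k IH]; first by rewrite expr0 expr1; lra.
have -> : k.+2%:R * z ^+ k.+1 * (r - z) =
    z * (k.+1%:R * z ^+ k * (r - z)) + z ^+ k.+1 * (r - z).
  by rewrite -[k.+2%:R]natr1 exprS; ring.
have -> : r ^+ k.+2 = z * r ^+ k.+1 + r ^+ k.+1 * (r - z) by rewrite exprS; ring.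
rewrite lerD ?ler_wpM2l// ler_wpM2r ?subr_ge0// lerXn2r// nnegrE//.
exact: le_trans zr.
Qed.

Lemma is_cvg_pseries_diffs c x z : cvgn (pseries c x) -> `|z| < `|x| ->
  cvgn (pseries (pseries_diffs c) z).
Proof.
move=> cx zx; pose r := (`|z| + `|x|) / 2.
have zr : `|z| < r by rewrite /r; lra.
have rx : `|r| < `|x| by rewrite ger0_norm /r; have := normr_ge0 z; lra.
have r0 : 0 <= r by have := normr_ge0 z; lra.
have := is_cvg_pseries_inside_norm cx rx.
set u := (fun i => `|c i|) => ur.
have {}ur : cvgn [series (u i.+1 * r ^+ i.+1) / (r - `|z|)]_i.
  rewrite (_ : [series _]_i = (r - `|z|)^-1 *: [series u i.+1 * r ^+ i.+1]_i).
    apply: is_cvgZr.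
    have -> : [series u i.+1 * r ^+ i.+1]_i =
        (fun n => pseries u r n.+1 - u 0%N).
      apply/funext => n; rewrite /pseries /series/= big_nat_recl//=.
      by rewrite expr0 mulr1 addrC addKr.
    have /cvg_ex[/= l ul] := ur; apply/cvg_ex; exists (l - u 0%N).
    by apply: cvgB; [rewrite (cvg_shiftS (pseries u r))|exact: cvg_cst].
  apply/funext => n; rewrite /series/= fctE /= scaler_sumr.
  by apply: eq_bigr => i _; rewrite [RHS]mulrC.
apply: normed_cvg; apply: series_le_cvg ur => /= n.
- exact: normr_ge0.
- by apply: divr_ge0; [apply: mulr_ge0; [exact: normr_ge0|exact: exprn_ge0]|rewrite subr_ge0 ltW].
- rewrite /pseries_diffs !normrM normrX ger0_norm// ler_pdivlMr ?subr_gt0//.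
  have := natrX_gap_le n (normr_ge0 z) (ltW zr).
  move=> /(ler_wpM2l (normr_ge0 (c n.+1))); apply: le_trans.
  by rewrite !mulrA (mulrC `|_|).
Qed.

Definition pseries_on H a c r :=
  forall y, `|y - a| < r -> pseries c (y - a) @ \oo --> H y.

Lemma pseries_on_is_derive H a c r y : pseries_on H a c r -> `|y - a| < r ->
  is_derive y (1 : R) H (limn (pseries (pseries_diffs c) (y - a))).
Proof.
(* [rho 1], [rho 2], [rho 3] are radii strictly between |y - a| and [r]. [pseries_snd_diffs] needs
   two formal derivatives to converge beyond |y - a|, and each formal differentiation costs one
   radius. *)
move=> Hc ya; pose rho i := `|y - a| + (r - `|y - a|) * i%:R / 4.
have cc i : (i < 4)%N -> (0 < i)%N -> `|rho i| < r /\ `|y - a| < `|rho i|.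
  move=> i4 i0.
  have : i%:R < 4 :> R by rewrite ltr_nat.
  have : 0 < i%:R :> R by rewrite ltr0n.
  move=> i0' i4'.
  have p : 0 < (r - `|y - a|) * i%:R by rewrite mulr_gt0// subr_gt0.
  have q : 0 < (r - `|y - a|) * (4 - i%:R) by rewrite mulr_gt0// subr_gt0.
  have n0 := normr_ge0 (y - a).
  by rewrite ger0_norm /rho; [split; lra|lra].
have rho_lt i j : (i < j)%N -> `|rho i| < `|rho j|.
  move=> ij; rewrite !ger0_norm /rho.
  - by rewrite ltrD2l ltr_pM2r// ltr_pM2l ?subr_gt0// ltr_nat.
  - by rewrite addr_ge0// divr_ge0// mulr_ge0// subr_ge0 ltW.
  - by rewrite addr_ge0// divr_ge0// mulr_ge0// subr_ge0 ltW.
have c3 : cvgn (pseries c (rho 3%N)).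
  have [h _] := cc 3%N isT isT.
  by have := Hc (rho 3%N + a); rewrite addrK => /(_ h) /cvgP.
have c2 := is_cvg_pseries_inside c3 (rho_lt 2 3 isT)%N.
have c1 := is_cvg_pseries_inside c2 (rho_lt 1 2 isT)%N.
have d2 := is_cvg_pseries_diffs c3 (rho_lt 2 3 isT)%N.
have d1 := is_cvg_pseries_inside d2 (rho_lt 1 2 isT)%N.
have e1 := is_cvg_pseries_diffs d2 (rho_lt 1 2 isT)%N.
have [_ y1] := cc 1%N isT isT.
have D := pseries_snd_diffs c1 d1 e1 y1.
have D' : is_derive y (1 : R) (fun z => limn (pseries c (z - a)))
    (limn (pseries (pseries_diffs c) (y - a))).
  have S : is_derive y (1 : R) (fun z => z - a) 1.
    by apply: (@eq_is_derive _ _ _ (id - cst a)) => //; rewrite subr0.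
  have := @is_derive1_comp R (fun z => limn (pseries c z)) (fun z => z - a) y
    (limn (pseries (pseries_diffs c) (y - a))) 1 D S.
  by move=> h; apply: (eq_is_derive _ h) => //=; rewrite mulr1.
apply: near_eq_is_derive D'.
have rya : 0 < r - `|y - a| by rewrite subr_gt0.
near=> z; apply: cvg_lim => //; apply: Hc.
have : `|y - z| < r - `|y - a|.
  by near: z; apply: nbhsx_ballx.
rewrite distrC => h.
by rewrite -(subrKA y) (le_lt_trans (ler_normD _ _))// -ltrBrDr.
Unshelve. all: by end_near. Qed.

End PowerSeries.

(** Connectedness of the real line suffices: [S] is restricted to the line through [x] and [y].
    Serves both for the identity theorem and for orbits. *)
Lemma normed_clopen_setT {R : realType} {V : normedModType R} (S : set V) x y :
  open S -> closed S -> S x -> S y.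
Proof.
move=> oS cS Sx; pose f (s : R) := x + s *: (y - x).
have cf : continuous f.
  by move=> s; apply: cvgD; [exact: cvg_cst|apply: cvgZr_tmp; exact: cvg_id].
have R_conn : connected [set: R] by apply/connected_intervalP.
have ST : f @^-1` S = setT.
  apply: R_conn.
  - by exists 0; rewrite /= /f scale0r addr0.
  - exists (f @^-1` S); last by rewrite setTI.
    by apply: open_comp => // s _; exact: cf.
  - exists (f @^-1` S); last by rewrite setTI.
    by apply: closed_comp => // s _; exact: cf.
have : (f @^-1` S) 1 by rewrite ST.
by rewrite /= /f scale1r subrKC.
Qed.

(** * Taylor coefficients, the identity theorem and genericity *)

Section Analytic.
Context {R : realType}.
Implicit Types (c d : nat -> R) (H : R -> R) (a x y z r : R).

Lemma pseries_on_center H a c r : 0 < r -> pseries_on H a c r -> c 0%N = H a.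
Proof.
move=> r0 /(_ a); rewrite subrr normr0 => /(_ r0).
move=> h; have : pseries c 0 @ \oo --> c 0%N.
  rewrite -cvg_shiftS; apply: cvg_near_cst; near=> n.
  rewrite /pseries /series/= big_nat_recl//= expr0 mulr1 big1 ?addr0//.
  by move=> i _; rewrite expr0n mulr0.
by move=> h'; exact: (cvg_unique _ h' h).
Unshelve. all: by end_near. Qed.

Lemma pseries_on_derive1 H a c r :
  pseries_on H a c r -> pseries_on H^`() a (pseries_diffs c) r.
Proof.
move=> Hc y ya; have hd := pseries_on_is_derive Hc ya.
rewrite derive1E derive_val.
pose x := (`|y - a| + r) / 2; have ya0 := normr_ge0 (y - a).
have xr : `|x| < r by rewrite ger0_norm /x; lra.
have yx : `|y - a| < `|x| by rewrite [ltRHS]ger0_norm /x; lra.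
have : cvgn (pseries c x) by have := Hc (x + a); rewrite addrK => /(_ xr) /cvgP.
by move=> /is_cvg_pseries_diffs /(_ yx).
Qed.

Lemma pseries_on_derive1n H a c r k :
  pseries_on H a c r -> pseries_on H^`(k) a (iter k (@pseries_diffs R) c) r.
Proof.
by move=> Hc; elim: k => [//|k IH]; rewrite derive1nS; exact: pseries_on_derive1.
Qed.

(** The coefficient is (i + k)! / i! times [c (i + k)], cross-multiplied to keep the induction free
    of division. *)
Lemma iter_pseries_diffs c k i :
  iter k (@pseries_diffs R) c i * i`!%:R = (i + k)`!%:R * c (i + k)%N.
Proof.
elim: k i => [|k IH] i; first by rewrite addn0 mulrC.
rewrite addnS -addSn -IH /= /pseries_diffs factS natrM; ring.
Qed.

Lemma pseries_on_taylor H a c r k : 0 < r -> pseries_on H a c r ->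
  H^`(k) a = k`!%:R * c k.
Proof.
move=> r0 /(@pseries_on_derive1n _ _ _ _ k)/(pseries_on_center r0) <-.
by have := iter_pseries_diffs c k 0; rewrite add0n fact0 mulr1.
Qed.

Lemma real_analyticP H : real_analytic H ->
  forall a, exists c r, 0 < r /\ pseries_on H a c r.
Proof.
move=> aH a; have [c /nbhs_ballP[r/= r0 hr]] := aH a.
by exists c, r; split => // y ya; apply: hr; rewrite /ball/= distrC.
Qed.

Lemma real_analytic_is_derive H k y : real_analytic H ->
  is_derive y (1 : R) H^`(k) (H^`(k.+1) y).
Proof.
move=> /real_analyticP /(_ y)[c [r [r0 /(@pseries_on_derive1n _ _ _ _ k) Hc]]].
have yr : `|y - y| < r by rewrite subrr normr0.
have h := pseries_on_is_derive Hc yr.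
by rewrite derive1nS derive1E; apply: derivableP; exact: ex_derive.
Qed.

Lemma real_analytic_derive1n H k : real_analytic H -> real_analytic H^`(k).
Proof.
move=> /real_analyticP aH a; have [c [r [r0 Hc]]] := aH a.
exists (iter k (@pseries_diffs R) c); apply/nbhs_ballP.
exists r => //= y ya; apply: (pseries_on_derive1n Hc); rewrite distrC; exact: ya.
Qed.

(* [reflected_jet al be H p q k s] is the k-th derivative of
   [s |-> al * H (p - s) + be * H (q + s)]. *)
Definition reflected_jet (al be : R) H (p q : R) k (s : R) :=
  al * (-1) ^+ k * derive1n k H (p - s) + be * derive1n k H (q + s).

Lemma reflected_jet_is_derive al be H p q k s : real_analytic H ->
  is_derive s (1 : R) (reflected_jet al be H p q k) (reflected_jet al be H p q k.+1 s).
Proof.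
move=> aH.
have S1 : is_derive s (1 : R) (fun s => p - s) (-1).
  by apply: (@eq_is_derive _ _ _ (cst p - id)) => //; rewrite sub0r.
have S2 : is_derive s (1 : R) (fun s => q + s) 1.
  by apply: (@eq_is_derive _ _ _ (cst q + id)) => //; rewrite add0r.
have D1 := @is_derive1_comp R H^`(k) _ s _ _ (real_analytic_is_derive k (p - s) aH) S1.
have D2 := @is_derive1_comp R H^`(k) _ s _ _ (real_analytic_is_derive k (q + s) aH) S2.
apply: (eq_is_derive _ (is_deriveD (is_deriveZ (al * (-1) ^+ k) D1) (is_deriveZ be D2))).
  by move=> t.
by rewrite /reflected_jet exprS /GRing.scale/=; ring.
Qed.

Lemma reflected_jet0_near al be H p q s0 : real_analytic H ->
  (forall k, reflected_jet al be H p q k s0 = 0) ->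
  \forall s \near s0, reflected_jet al be H p q 0 s = 0.
Proof.
move=> /real_analyticP aH jet0.
have [c [r1 [r10 Hc]]] := aH (p - s0); have [d [r2 [r20 Hd]]] := aH (q + s0).
near=> s.
have s1 : `|p - s - (p - s0)| < r1.
  by rewrite (_ : _ - _ = s0 - s); [near: s; exact: nbhsx_ballx|ring].
have s2 : `|q + s - (q + s0)| < r2.
  rewrite (_ : _ - _ = s - s0); last by ring.
  by rewrite distrC; near: s; exact: nbhsx_ballx.
have lim1 : (fun n => al * pseries c (p - s - (p - s0)) n +
    be * pseries d (q + s - (q + s0)) n) @ \oo --> al * H (p - s) + be * H (q + s).
  by apply: cvgD; apply: cvgMl_tmp; [exact: Hc|exact: Hd].
rewrite /reflected_jet expr0 mulr1.
rewrite -(cvg_lim (@Rhausdorff R) lim1); apply: (cvg_lim (@Rhausdorff R)).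
rewrite (_ : (fun _ => _) = cst 0); first exact: cvg_cst.
apply/funext => n /=; rewrite /pseries /series/= !mulr_sumr -big_split/=.
apply: big1 => i _.
have -> : p - s - (p - s0) = - (s - s0) by ring.
have -> : q + s - (q + s0) = s - s0 by ring.
rewrite exprNn.
(* Multiplied by i!, this Taylor coefficient is the i-th jet at [s0]. *)
suff E : al * (-1) ^+ i * c i + be * d i = 0.
  rewrite (_ : _ + _ = (al * (-1) ^+ i * c i + be * d i) * (s - s0) ^+ i).
    by rewrite E mul0r.
  by ring.
have fi : i`!%:R != 0 :> R by rewrite pnatr_eq0 -lt0n fact_gt0.
apply: (mulfI fi); rewrite mulr0 -[RHS](jet0 i) /reflected_jet.
by rewrite (pseries_on_taylor i r10 Hc) (pseries_on_taylor i r20 Hd); ring.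
Unshelve. all: by end_near. Qed.

(** Identity theorem: the points where all jets vanish form a closed set by continuity, and an open
    one because the function then vanishes nearby, and with it all its derivatives. *)
Lemma reflected_jet0 al be H p q : real_analytic H ->
  (forall k, reflected_jet al be H p q k 0 = 0) ->
  forall s, al * H (p - s) + be * H (q + s) = 0.
Proof.
move=> aH jet0.
pose S := [set s | forall k, reflected_jet al be H p q k s = 0].
have open_S : open S.
  rewrite openE => s Ss.
  have /nbhs_ballP[e/= e0 he] := reflected_jet0_near aH Ss.
  apply/nbhs_ballP; exists e => //= t ht k.
  elim: k t ht => [|k IH] t ht; first exact: he.
  have hk := reflected_jet_is_derive al be p q k t aH.
  have h0 : is_derive t (1 : R) (cst 0) (reflected_jet al be H p q k.+1 t).
    apply: near_eq_is_derive hk; near=> u; apply: IH.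
    near: u; apply: open_nbhs_nbhs; split => //; exact: ball_open.
  by rewrite -(@derive_val _ _ _ _ _ _ _ h0) derive_cst.
have closed_S : closed S.
  rewrite (_ : S = \bigcap_k (reflected_jet al be H p q k @^-1` [set 0])); last first.
    by apply/seteqP; split=> [s Ss k _|s Ss k]; [exact: Ss|exact: Ss].
  apply: closed_bigI => k _; apply: closed_comp; last exact: closed_eq.
  move=> s _; have := reflected_jet_is_derive al be p q k s aH => ?.
  by apply/differentiable_continuous/derivable1_diffP.
move=> s; have : S s by exact: (@normed_clopen_setT R R^o S 0 s open_S closed_S jet0).
by move=> /(_ 0%N); rewrite /reflected_jet expr0 mulr1.
Unshelve. all: by end_near. Qed.

(** If all these combinations vanished, the identity theorem would give al H(p - s) + be H(q + s) =
    0 for H = Phi''. For [al] nonzero this reads H(t) = la H(p + q - t); applying the reflection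
    twice forces la^2 = 1 unless H = 0, so H is even or odd about (p + q) / 2. The zero function is
    even, which covers the remaining case. *)
Lemma generic_jet (Phi : R -> R) al be p q :
  real_analytic Phi -> generic_potential Phi -> (al != 0) || (be != 0) ->
  exists k, al * (-1) ^+ k * derive1n k.+2 Phi p + be * derive1n k.+2 Phi q != 0.
Proof.
move=> aPhi gPhi albe; apply/not_existsP => jet0; apply: gPhi.
pose H := Phi^`(2).
have aH : real_analytic H by exact: real_analytic_derive1n.
have HE s : al * H (p - s) + be * H (q + s) = 0.
  apply: reflected_jet0 => // k; rewrite /reflected_jet subr0 addr0.
  have -> : H^`(k) = Phi^`(k.+2) by rewrite /derive1n -iterD addn2.
  by apply/eqP; apply: contrapT => /negP; exact: jet0.
have zero_case : (forall t, H t = 0) ->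
    exists b h, (even_fun h \/ odd_fun h) /\ forall t, Phi^`(2) t = h (t - b).
  by move=> H0; exists 0, (fun=> 0); split; [left|].
have [al0|al0] := eqVneq al 0.
  apply: zero_case => t; have := HE (t - q); rewrite al0 mul0r add0r subrKC.
  by move: albe; rewrite al0 eqxx/= => /mulfI be0 E; apply: be0; rewrite mulr0.
have reflect t : H t = - (be / al) * H (p + q - t).
  have := HE (p - t); rewrite subKr addrA (addrC q).
  move: (H t) (H _) => u v E.
  by apply: (mulfI al0); rewrite mulNr mulrN mulrA mulrCA mulfV// mulr1; lra.
set la := - (be / al) in reflect.
have refl2 t : H t = la ^+ 2 * H t.
  by rewrite {1}reflect reflect subKr mulrA.
have [H0|] := pselect (forall t, H t = 0); first exact: zero_case.
move=> /existsNP[t0 /eqP Ht0].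
have : la ^+ 2 = 1 by apply: (mulIf Ht0); rewrite mul1r -refl2.
move=> /eqP; rewrite sqrf_eq1 => la1.
exists ((p + q) / 2), (fun t => H (t + (p + q) / 2)); split; last first.
  by move=> t; rewrite subrK.
case/orP: la1 => /eqP la1; [left|right] => t; rewrite reflect la1.
- by rewrite mul1r; congr H; field.
- by rewrite mulN1r; congr (- H _); field.
Qed.

End Analytic.

(** * Brackets of the chain *)

Section Chain.
Context {R : realType} {n : nat} (F : nat -> R -> R).
Hypothesis n_gt1 : (1 < n)%N.
Hypothesis dF : forall k y, is_derive y (1 : R) (F k) (F k.+1 y).
Notation V := 'rV[R]_(n + n).
Let smooth := @smooth R (n + n) F.
Let sfield := @sfield R (n + n) F.
Implicit Types (k : 'I_n) (x : V).

Context {f : V -> V}.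
Hypothesis driftq :
  forall k, (fun x => f x 0 (lshift n k)) = fun x => x 0 (rshift n k).
Hypothesis driftp : forall k, (fun x => f x 0 (rshift n k)) =
  fun x => F 1 (x 0 (lshift n (ord_pred k)) - x 0 (lshift n k))
         - F 1 (x 0 (lshift n k) - x 0 (lshift n (ordS k))).

Definition qdir k : V -> V := fun=> delta_mx 0 (lshift n k).
Definition pdir k : V -> V := fun=> delta_mx 0 (rshift n k).

Lemma sfield_drift : sfield f.
Proof.
move=> i; case: (split_ordP i) => k ->.
  by rewrite driftq; exact: smooth_coord.
by rewrite driftp; apply: smooth_sub; exact: smooth_gap.
Qed.

Lemma sfield_cst (v : V) : sfield (fun=> v).
Proof. by move=> i; exact: smooth_cst. Qed.

Lemma lie_bracket_cst (X : V -> V) v (i : 'I_(n + n)) : sfield X ->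
  (fun x => lie_bracket X (fun=> v) x 0 i) =
  fun x => - der (fun=> v) (fun x => X x 0 i) x.
Proof.
move=> sX; rewrite (lie_bracketE dF i sX (sfield_cst v)) der_cst.
by apply/funext => x; rewrite sub0r.
Qed.

Lemma basisE (i j : 'I_(n + n)) : (delta_mx 0 i : V) 0 j = (j == i)%:R.
Proof. by rewrite mxE eqxx. Qed.

Lemma der_basis_gap (l i j : 'I_(n + n)) m :
  der (fun=> delta_mx 0 l) (fun x : V => F m (x 0 i - x 0 j)) =
  fun x => F m.+1 (x 0 i - x 0 j) * ((i == l)%:R - (j == l)%:R).
Proof. by rewrite (der_gap dF); apply/funext => x; rewrite !basisE. Qed.

Lemma der_basis_driftp (l : 'I_(n + n)) k :
  der (fun=> delta_mx 0 l) (fun x => f x 0 (rshift n k)) =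
  fun x => F 2 (x 0 (lshift n (ord_pred k)) - x 0 (lshift n k)) *
    ((lshift n (ord_pred k) == l)%:R - (lshift n k == l)%:R) -
    F 2 (x 0 (lshift n k) - x 0 (lshift n (ordS k))) *
    ((lshift n k == l)%:R - (lshift n (ordS k) == l)%:R).
Proof.
rewrite driftp (der_sub dF _ (@smooth_gap R _ F 1 _ _) (@smooth_gap R _ F 1 _ _)).
by rewrite !(der_basis_gap _ _ _ 1).
Qed.

Lemma bracket_drift_pdir k : lie_bracket f (pdir k) = - qdir k.
Proof.
apply: eq_field => i; rewrite (lie_bracket_cst _ _ sfield_drift).
apply/funext => x; rewrite [RHS]mxE; congr (- _).
case: (split_ordP i) => j ->.
  by rewrite driftq der_coord !basisE !eq_shift.
by rewrite der_basis_driftp basisE !eq_shift !subrr !mulr0 subr0.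
Qed.

Definition fwd_jet k j : V -> R :=
  fun x => F j.+2 (x 0 (lshift n k) - x 0 (lshift n (ordS k))).

Definition bwd_jet k j : V -> R :=
  fun x => (-1) ^+ j * F j.+2 (x 0 (lshift n (ord_pred k)) - x 0 (lshift n k)).

Lemma smooth_fwd_jet k j : smooth (fwd_jet k j).
Proof. exact: smooth_gap. Qed.

Lemma smooth_bwd_jet k j : smooth (bwd_jet k j).
Proof. by apply: smooth_scale; exact: smooth_gap. Qed.

(** Uses [n_gt1]. Thanks to it the gap between neighbouring sites really depends on q_k, with
    derivative 1 or -1. *)
Lemma ordS_neq k : ordS k == k = false.
Proof.
apply/negbTE/eqP => /(congr1 val)/= E; have := ltn_ord k.
rewrite leq_eqVlt => /orP[/eqP kn|kn].
  by move: E; rewrite kn modnn => k0; move: n_gt1; rewrite -kn -k0.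
by move: E; rewrite modn_small// => /eqP; rewrite gtn_eqF.
Qed.

Lemma ord_pred_neq k : ord_pred k == k = false.
Proof. by rewrite -(ordS_neq (ord_pred k)) ord_predK eq_sym. Qed.

(** Each bracket with the constant field [qdir k] differentiates the two force gradients in q_k. The
    backward gap contains q_k with a minus sign, hence the (-1)^j in [bwd_jet]. *)
Lemma bracket_drift_qdir k j :
  iter j (lie_bracket (qdir k)) (lie_bracket f (qdir k)) =
  (fun x => fwd_jet k j x *: (pdir k x - pdir (ordS k) x)) +
  (fun x => bwd_jet k j x *: (pdir k x - pdir (ord_pred k) x)).
Proof.
elim: j => [|j IH].
  rewrite [LHS]/=; apply: eq_field => i; rewrite (lie_bracket_cst _ _ sfield_drift).
  apply/funext => x; rewrite [RHS]mxE [X in _ = X + _]mxE [X in _ = _ + X]mxE.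
  rewrite [X in _ = _ * X + _]mxE [X in _ = _ + _ * X]mxE.
  rewrite [X in _ = _ * (_ + X) + _]mxE [X in _ = _ + _ * (_ + X)]mxE !basisE.
  rewrite /fwd_jet /bwd_jet.
  case: (split_ordP i) => l ->.
    by rewrite driftq der_coord !basisE !eq_shift !subrr !mulr0 addr0 oppr0.
  rewrite der_basis_driftp !eq_shift expr0 mul1r.
  have -> : (ord_pred l == k) = (l == ordS k).
    by rewrite (can2_eq (@ord_predK n) (@ordSK n)).
  have -> : (ordS l == k) = (l == ord_pred k).
    by rewrite (can2_eq (@ordSK n) (@ord_predK n)).
  (* The indicator lives at l = ordS k, where [ord_pred l] is [k]: the gap next to it may be written
     in terms of [k] alone. Same for [bwdE]. *)
  have fwdE (c : R) : F 2 (x 0 (lshift n (ord_pred l)) - x 0 (lshift n l)) *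
      ((l == ordS k)%:R - c) =
      F 2 (x 0 (lshift n k) - x 0 (lshift n (ordS k))) * (l == ordS k)%:R -
      F 2 (x 0 (lshift n (ord_pred l)) - x 0 (lshift n l)) * c.
    by have [->|_] := eqVneq l (ordS k); rewrite ?ordSK mulrBr ?mulr1 ?mulr0.
  have bwdE (c : R) : F 2 (x 0 (lshift n l) - x 0 (lshift n (ordS l))) *
      (c - (l == ord_pred k)%:R) =
      F 2 (x 0 (lshift n l) - x 0 (lshift n (ordS l))) * c -
      F 2 (x 0 (lshift n (ord_pred k)) - x 0 (lshift n k)) * (l == ord_pred k)%:R.
    by have [->|_] := eqVneq l (ord_pred k); rewrite ?ord_predK mulrBr ?mulr1 ?mulr0.
  rewrite fwdE bwdE.
  by have [->|_] := eqVneq l k; rewrite /= ?mulr1n ?mulr0n; ring.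
rewrite iterS IH.
have sc (v : V) : sfield (fun=> v) by exact: sfield_cst.
have dfwd : der (qdir k) (fwd_jet k j) = fwd_jet k j.+1.
  rewrite (der_basis_gap _ _ _ j.+2) !eq_shift eqxx ordS_neq.
  by apply/funext => x; rewrite subr0 mulr1.
have dbwd : der (qdir k) (bwd_jet k j) = bwd_jet k j.+1.
  rewrite /bwd_jet (der_mul dF _ (smooth_cst _ _) (@smooth_gap R _ F j.+2 _ _)).
  rewrite der_cst (der_basis_gap _ _ _ j.+2) !eq_shift eqxx ord_pred_neq.
  by apply/funext => x; rewrite /bwd_jet exprS /= mulr1n mulr0n; ring.
have step a (v : V) : smooth a ->
    lie_bracket (qdir k) (fun x => a x *: v) = fun x => der (qdir k) a x *: v.
  move=> sa; rewrite (lie_bracket_scaler dF sa (sc _) (sc v)).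
  apply/funext => x; rewrite !fctE.
  suff -> : lie_bracket (qdir k) (fun=> v) x = 0 by rewrite scaler0 add0r.
  apply/rowP => i; rewrite [LHS](congr1 (@^~ x) (lie_bracket_cst _ _ (sc _))).
  by rewrite der_cst oppr0 mxE.
rewrite (lie_bracket_addr dF (sc _)).
- rewrite (step _ (pdir k 0 - pdir (ordS k) 0) (smooth_fwd_jet k j)) dfwd.
  by rewrite (step _ (pdir k 0 - pdir (ord_pred k) 0) (smooth_bwd_jet k j)) dbwd.
- exact: (sfield_scale (smooth_fwd_jet k j) (sc (pdir k 0 - pdir (ordS k) 0))).
- exact: (sfield_scale (smooth_bwd_jet k j) (sc (pdir k 0 - pdir (ord_pred k) 0))).
Qed.

Hypothesis generic : forall al be p q : R, (al != 0) || (be != 0) ->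
  exists j : nat, al * (-1) ^+ j * F j.+2 p + be * F j.+2 q != 0.

Context {L : set (V -> V)}.
Hypothesis L_closed : lie_closed L.
Hypothesis L_smooth : forall X, L X -> sfield X.
Hypothesis L_drift : L f.
Context {k0 : 'I_n}.
Hypothesis k0E : val k0 = 0%N.
Hypothesis L_control : L (pdir k0).
Context {x0 : V}.
Notation N := (@lie_local R (n + n) F L x0).

Lemma lie_local_drift : N f. Proof. exact: lie_local_base. Qed.

Lemma lie_local_qdir k : N (pdir k) -> N (qdir k).
Proof.
move=> Nk; have := lie_local_bracket dF L_closed L_smooth lie_local_drift Nk.
rewrite bracket_drift_pdir => h; rewrite -[qdir k]opprK -sub0r.
apply: lie_local_sub => //; rewrite -(subrr f).
by apply: lie_local_sub; exact: lie_local_drift.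
Qed.

(** The iterated brackets also have a component along [pdir k]; it is a function multiple of a field
    already reached and is subtracted. *)
Lemma lie_local_jet k j : N (pdir k) ->
  N ((fun x => fwd_jet k j x *: pdir (ordS k) x) +
     (fun x => bwd_jet k j x *: pdir (ord_pred k) x)).
Proof.
move=> Nk; have Nq := lie_local_qdir Nk.
have NT : N (iter j (lie_bracket (qdir k)) (lie_bracket f (qdir k))).
  elim: j => [|j IH]; last exact: lie_local_bracket.
  by apply: lie_local_bracket => //; exact: lie_local_drift.
rewrite (_ : _ + _ = (fun x => (fwd_jet k j x + bwd_jet k j x) *: pdir k x) -
    iter j (lie_bracket (qdir k)) (lie_bracket f (qdir k))).
  apply: lie_local_sub => //; apply: lie_local_scale => //.
  by apply: smooth_add; [exact: smooth_fwd_jet|exact: smooth_bwd_jet].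
rewrite bracket_drift_qdir; apply/funext => x; rewrite !fctE.
move: (pdir k x) (pdir (ordS k) x) (pdir (ord_pred k) x) => u v w.
move: (fwd_jet k j x) (bwd_jet k j x) => a b.
by apply/rowP => i; rewrite !mxE; ring.
Qed.

Lemma lie_local_pdirS k : N (pdir k) ->
  val k = 0%N \/ N (pdir (ord_pred k)) -> N (pdir (ordS k)).
Proof.
move=> Nk prevk.
pose q := x0 0 (lshift n k) - x0 0 (lshift n (ordS k)).
pose p := x0 0 (lshift n (ord_pred k)) - x0 0 (lshift n k).
(* With coefficients 0 and 1, genericity gives an order at which the forward jet is nonzero at
   [x0]. *)
have [|j0] := @generic 0 1 p q; first by rewrite oner_neq0 orbT.
rewrite !mul0r add0r mul1r => Aj0.
have sp l : sfield (pdir l) by exact: sfield_cst.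
have [k_0|Npred] := prevk; last first.
  apply: (lie_local_div (smooth_fwd_jet k j0) Aj0 (sp _)).
  have := lie_local_sub (lie_local_jet j0 Nk)
    (lie_local_scale (smooth_bwd_jet k j0) Npred).
  by rewrite addrK.
have [|l] := @generic (- F j0.+2 q) ((-1) ^+ j0 * F j0.+2 p) p q.
  by rewrite oppr_eq0 Aj0.
rewrite -/p -/q => Al.
have := lie_local_sub (lie_local_scale (smooth_bwd_jet k l) (lie_local_jet j0 Nk))
  (lie_local_scale (smooth_bwd_jet k j0) (lie_local_jet l Nk)).
set X := (X in N X -> _).
have -> : X = fun x => (bwd_jet k l x * fwd_jet k j0 x -
    bwd_jet k j0 x * fwd_jet k l x) *: pdir (ordS k) x.
  apply/funext => x; rewrite /X !fctE.
  by apply/rowP => i; rewrite !mxE; ring.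
apply: lie_local_div; last exact: sp.
  by apply: smooth_sub; apply: smooth_mul;
    [exact: smooth_bwd_jet|exact: smooth_fwd_jet|exact: smooth_bwd_jet|
     exact: smooth_fwd_jet].
move: Al; apply: contraNneq; rewrite /bwd_jet /fwd_jet -/p -/q => E.
by rewrite -oppr_eq0 -[X in _ == X]E; apply/eqP; ring.
Qed.

Lemma lie_local_pdir k : N (pdir k).
Proof.
(* Two consecutive sites are carried along, because reaching a site uses the two before it. *)
suff H m : (forall k, val k = m -> N (pdir k)) /\
    (forall k, val k = m.+1 -> N (pdir k)) by exact: (H (val k)).1.
have predE (i : 'I_n) j : val i = j.+1 -> val (ord_pred i) = j.
  move=> ij; have ji := ltn_ord i; rewrite -[nat_of_ord i]/(val i) ij in ji.
  by rewrite /= -[nat_of_ord i]/(val i) ij addSn /= modnDr modn_small// ltnW.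
elim: m => [|m [IH0 IH1]]; split => // {}k km.
- by rewrite (_ : k = k0); [exact: lie_local_base|apply: val_inj; rewrite km].
- rewrite -(ord_predK k); have k'0 := predE _ _ km.
  apply: lie_local_pdirS; last by left.
  rewrite (_ : ord_pred k = k0); first exact: lie_local_base.
  by apply: val_inj; rewrite k'0.
- rewrite -(ord_predK k); have k'1 := predE _ _ km.
  apply: lie_local_pdirS; first exact: IH1.
  by right; apply: IH0; exact: predE.
Qed.

Lemma chain_bracket_generating : [set X x0 | X in L] = setT.
Proof.
apply/seteqP; split => // v _.
have Nv : N (fun=> v).
  have -> : (fun=> v) = \sum_i (fun=> v 0 i *: (delta_mx 0 i : V)) :> (V -> V).
    by apply/funext => x; rewrite fct_sumE -row_sum_delta.
  elim/big_ind: _ => [|X Y NX NY|i _].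
  - by rewrite -(subrr f); apply: lie_local_sub; exact: lie_local_drift.
  - exact: lie_local_add.
  - apply: lie_local_scale; first exact: smooth_cst.
    case: (split_ordP i) => k ->; last exact: lie_local_pdir.
    exact/lie_local_qdir/lie_local_pdir.
exact: (lie_local_eval L_closed Nv).
Qed.

End Chain.

(** * Ordinary differential equations *)

(** Lets row vectors be used as a complete normed module, as [geometric_cvg] requires. *)
HB.instance Definition _ (R : realType) (m n : nat) :=
  Complete.copy 'M[R]_(m, n) 'M[R]_(m, n).

Section Curves.
Context {R : realType} {m : nat}.
Notation V := 'rV[R]_m.
Implicit Types (h : R -> R) (c d : R -> V).

Lemma is_derive_continuous {W : normedModType R} (c c' : R -> W) :
  (forall t, is_derive t (1 : R) c (c' t)) -> continuous c.
Proof.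
move=> dc t; have := dc t => ?.
by apply/differentiable_continuous/derivable1_diffP.
Qed.

Lemma is_derive_row (c : R -> V) (v : V) (t : R) :
  is_derive t (1 : R) c v <->
  forall i, is_derive t (1 : R) (fun s => c s 0 i) (v 0 i).
Proof.
split=> [dc i|dc].
  have h : derivable c t 1 by [].
  split; first by move/derivable_mxP : h; apply.
  by rewrite -[v](@derive_val _ _ _ _ _ _ _ dc) derive_mx// mxE.
have h : derivable c t 1.
  by apply/derivable_mxP => i j; rewrite (ord1 i); have := dc j => ?.
split => //; rewrite derive_mx//; apply/rowP => i; rewrite mxE.
by have := dc i => ?; rewrite derive_val.
Qed.

Lemma mean_value_le_row (c c' : R -> V) (a b C u w : R) :
  (forall s, a < s < b -> is_derive s (1 : R) c (c' s)) ->
  (forall s, a < s < b -> `|c' s| <= C) ->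
  a < u < b -> a < w < b -> `|c u - c w| <= C * `|u - w|.
Proof.
move=> dc bc hu hw; apply: row_norm_le => [|i].
  by rewrite mulr_ge0// (le_trans (normr_ge0 _) (bc _ hu)).
rewrite !mxE.
apply: (@mean_value_le R (fun s => c s 0 i) (fun s => c' s 0 i) a b) => //.
  by move=> s /dc /is_derive_row.
by move=> s /bc; apply: le_trans; exact: coord_le_norm.
Qed.

Lemma primitive_right h (a : R) : continuous h ->
  exists H : R -> R, forall t, a < t -> is_derive t (1 : R) H (h t).
Proof.
move=> ch; exists (fun x => \int[lebesgue_measure]_(t in `[a, x]) h t)%R => t at_.
have tt : t < t + 1 by rewrite ltrDl.
have ih : lebesgue_measure.-integrable `[a, t + 1] (EFin \o h).
  apply: continuous_compact_integrable; first exact: segment_compact.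
  exact: continuous_subspaceT.
have [dH EH] := continuous_FTC1_closed tt ih at_ (ch t).
by split; [exact: dH|rewrite -EH derive1E].
Qed.

Lemma primitive h : continuous h ->
  exists H : R -> R, H 0 = 0 /\ forall t, is_derive t (1 : R) H (h t).
Proof.
move=> ch; have [I dI] := choice (fun a => primitive_right a ch).
(* The base point -(|t| + 1) lies left of both [t] and 0. Changing it only adds a constant to [I],
   so near [t0] this agrees with the primitive from the fixed, more remote base point [a0]. *)
pose H t := I (- (`|t| + 1)) t - I (- (`|t| + 1)) 0.
exists H; split => [|t0]; first by rewrite /H subrr.
pose a0 := - (`|t0| + 2).
have a0t : a0 < t0 by have := lerNnormlW (lexx `|t0|); rewrite /a0; lra.
apply: (@near_eq_is_derive _ _ _ (I a0 - cst (I a0 0))); last first.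
  have ? := dI a0 _ a0t.
  by rewrite -[h t0]subr0; exact: is_deriveB.
near=> t.
have tt0 : `|t0 - t| < 1 by near: t; exact: nbhsx_ballx.
have tn : `|t| < `|t0| + 1.
  rewrite -ltrBlDl; apply: le_lt_trans tt0.
  by rewrite distrC; apply: lerB_dist.
pose a := - (`|t| + 1); rewrite !fctE /H -/a.
have aa0 : a0 < a by rewrite /a0 /a; lra.
have tl : - `|t| <= t <= `|t| by rewrite -ler_norml.
have n0 := normr_ge0 t.
have E : I a t - I a0 t - (I a 0 - I a0 0) = 0.
  apply/eqP; rewrite -normr_le0 -[leRHS](mul0r `|t - 0|).
  apply: (@mean_value_le R (fun s => I a s - I a0 s) (fun=> 0) a (`|t| + 1)).
  - move=> s /andP[as_ _].
    have ? := dI a _ as_; have ? := dI a0 _ (lt_trans aa0 as_).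
    by rewrite -[0](subrr (h s)); exact: is_deriveB.
  - by move=> s _; rewrite normr0.
  - by rewrite /a; apply/andP; split; lra.
  - by rewrite /a; apply/andP; split; lra.
rewrite /cst; move: (I a t) (I a0 t) (I a 0) (I a0 0) E => ? ? ? ? ?; lra.
Unshelve. all: by end_near. Qed.

(** A single operator [P] for all curves, so that the Picard map can be iterated as a function; its
    value on a discontinuous curve is arbitrary. *)
Lemma primitive_row : exists P : (R -> V) -> R -> V, forall c, continuous c ->
  P c 0 = 0 /\ forall t, is_derive t (1 : R) (P c) (c t).
Proof.
suff /choice[P HP] : forall c : R -> V, exists d : R -> V, continuous c ->
  d 0 = 0 /\ forall t, is_derive t (1 : R) d (c t) by exists P.
move=> c; have [cc|] := pselect (continuous c); last by exists c.
have ci i : continuous (fun s => c s 0 i).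
  move=> t; apply: (@continuous_comp _ _ _ c (fun v : V => v 0 i)).
      exact: cc.
    exact: coord_continuous.
have [d Hd] := choice (fun i => primitive (ci i)).
exists (fun t => \row_i d i t) => _; split=> [|t].
  by apply/rowP => i; rewrite !mxE (Hd i).1.
apply/is_derive_row => i.
by rewrite (_ : (fun s => _) = d i); [exact: (Hd i).2|
  apply/funext => s; rewrite mxE].
Qed.

(** Carries estimates on the iterates, which are within C / 2^k of their limit, over to the
    limit. *)
Lemma le_geometric (a b C : R) : (forall k, a <= b + C / 2 ^+ k) -> a <= b.
Proof.
move=> H; have : b + C / 2 ^+ k @[k --> \oo] --> b + 0.
  apply: cvgD; first exact: cvg_cst.
  rewrite -[0](mulr0 C); apply: cvgMl_tmp.
  have /= := @cvg_geometric R 1 2^-1.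
  rewrite /geometric/=; under eq_fun do rewrite mul1r exprVn; apply.
  by rewrite ger0_norm; lra.
rewrite addr0 => h; rewrite -(cvg_lim (@Rhausdorff R) h).
by apply: limr_ge; [exact: cvgP h|exact: nearW].
Qed.

Lemma geometric_cvg {W : completeNormedModType R} (u : nat -> W) (C : R) :
  (forall k, `|u k.+1 - u k| <= C / 2 ^+ k) ->
  exists l, forall k, `|l - u k| <= 2 * C / 2 ^+ k.
Proof.
move=> uC.
have C0 : 0 <= C by have := le_trans (normr_ge0 _) (uC 0%N); rewrite divr1.
have cu : cvgn u.
  have -> : u = (fun n => u 0%N + series (telescope u) n).
    by apply/funext => n; exact: eq_sum_telescope.
  apply: is_cvgD; first exact: is_cvg_cst.
  apply: normed_cvg; apply: (@series_le_cvg _ _ (geometric C 2^-1)).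
  - by move=> n; exact: normr_ge0.
  - by move=> n; rewrite /geometric/= mulr_ge0// exprn_ge0.
  - by move=> n; rewrite /geometric/= exprVn; exact: uC.
  - by apply: is_cvg_geometric_series; rewrite ger0_norm; lra.
exists (limn u) => k.
have H n : `|u (k + n)%N - u k| <= 2 * C * (2^-1 ^+ k - 2^-1 ^+ (k + n)).
  elim: n => [|n IH]; first by rewrite addn0 !subrr normr0 mulr0.
  rewrite -(subrKA (u (k + n)%N)) (le_trans (ler_normD _ _))// addnS.
  have := lerD (uC (k + n)%N) IH; rewrite -exprVn exprS; lra.
have : `|u n - u k| @[n --> \oo] --> `|limn u - u k|.
  by apply: cvg_norm; apply: cvgB => //; exact: cvg_cst.
move=> h; rewrite -(cvg_lim (@Rhausdorff R) h).
apply: limr_le; first exact: cvgP h.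
exists k => // n /= kn.
rewrite -(subnKC kn); apply: (le_trans (H _)).
rewrite -exprVn ler_wpM2l//; first by lra.
by rewrite gerBl exprn_ge0.
Qed.

End Curves.

(** * Picard iteration for a globally Lipschitz field *)

Section Picard.
Context {R : realType} {m : nat}.
Notation V := 'rV[R]_m.

Lemma lipschitz_continuous {U W : normedModType R} (X : U -> W) (K : R) :
  (forall a b, `|X a - X b| <= K * `|a - b|) -> continuous X.
Proof.
move=> XK a; apply/cvgrPdist_le => /= e e0.
have K0 : 0 < `|K| + 1 by rewrite ltr_wpDl.
near=> b; apply: (le_trans (XK _ _)).
have ab : `|a - b| <= e / (`|K| + 1).
  by near: b; apply: cvgr_dist_le; rewrite ?divr_gt0//; exact: cvg_id.
apply: (@le_trans _ _ ((`|K| + 1) * `|a - b|)).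
  by rewrite ler_wpM2r// (le_trans (ler_norm _))// lerDl.
by rewrite -ler_pdivlMl// mulrC.
Unshelve. all: by end_near. Qed.

Lemma is_derive_sub {W : normedModType R} (c d : R -> W) (c' d' : W) (t : R) :
  is_derive t (1 : R) c c' -> is_derive t (1 : R) d d' ->
  is_derive t (1 : R) (fun s => c s - d s) (c' - d').
Proof. by move=> ? ?; exact: is_deriveB. Qed.

Lemma mean_value_le_centered (c c' : R -> V) (S B u w : R) :
  (forall s, `|s| < S -> is_derive s (1 : R) c (c' s)) ->
  (forall s, `|s| < S -> `|c' s| <= B) ->
  `|u| < S -> `|w| < S -> `|c u - c w| <= B * `|u - w|.
Proof.
move=> dc bc; rewrite !ltr_norml => uS wS.
by apply: (mean_value_le_row _ _ uS wS) => s; rewrite -ltr_norml;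
  [exact: dc|exact: bc].
Qed.

(** A 1-Lipschitz retraction onto [-r, r]. It makes locally defined objects global: in time for the
    Picard limit, in space for a locally Lipschitz field. *)
Definition clamp (r s : R) : R := Num.max (- r) (Num.min r s).

Lemma clamp_norm r s : 0 <= r -> `|clamp r s| <= r.
Proof.
by move=> r0; rewrite ler_norml /clamp le_max lexx ge_max ge_min lexx andbT; lra.
Qed.

Lemma clamp_id r s : `|s| <= r -> clamp r s = s.
Proof.
rewrite ler_norml => /andP[rs sr]; rewrite /clamp min_r// max_r//.
Qed.

Lemma clamp_lipschitz r s t : 0 <= r -> `|clamp r s - clamp r t| <= `|s - t|.
Proof.
move=> r0; have := ler_norm (s - t); have := ler_norm (t - s).
rewrite (distrC t) ler_norml /clamp; move: `|s - t| => u ? ?.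
by case: (leP r s) => ?; case: (leP r t) => ?; do ?case: (leP (- r)) => ?;
  apply/andP; split; lra.
Qed.

Context {X : V -> V} {K : R}.
Hypothesis K_gt0 : 0 < K.
Hypothesis X_lipschitz : forall a b, `|X a - X b| <= K * `|a - b|.

Lemma picard : exists phi : R -> V -> V,
  [/\ forall y, phi 0 y = y,
      forall t y, `|t| < (4 * K)^-1 ->
        is_derive t (1 : R) (phi^~ y) (X (phi t y)),
      forall t y z, `|t| < (4 * K)^-1 -> `|phi t y - phi t z| <= 2 * `|y - z| &
      forall t y, `|t| < (4 * K)^-1 -> `|phi t y - y| <= 2 * `|X y| * `|t|].
Proof.
have [P HP] := @primitive_row R m.
pose ga k y := iter k (fun (c : R -> V) t => y + P (X \o c) t) (fun=> y).
have cX : continuous X := lipschitz_continuous X_lipschitz.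
have cXo (c : R -> V) : continuous c -> continuous (X \o c).
  by move=> cc t; apply: continuous_comp; [exact: cc|exact: cX].
have dP (c : R -> V) y t : continuous c ->
    is_derive t (1 : R) (fun s => y + P (X \o c) s) (X (c t)).
  move=> cc; have [_ dPc] := HP _ (cXo _ cc); have ? := dPc t.
  by rewrite -[X (c t)]add0r; exact: is_deriveD.
have cga k y : continuous (ga k y).
  elim: k => [|k IH]; first by move=> t; exact: cvg_cst.
  by apply: (@is_derive_continuous _ _ _ (fun t => X (ga k y t))) => t; exact: dP.
have dga k y t : is_derive t (1 : R) (ga k.+1 y) (X (ga k y t)).
  by apply: dP; exact: cga.
have ga0 k y : ga k y 0 = y.
  by case: k => [//|k]; rewrite /ga iterS (HP _ (cXo _ (cga k y))).1 addr0.
(* With K T = 1/2, each Picard step halves the distance between successive iterates. *)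
pose T := (2 * K)^-1.
have T0 : 0 < T by rewrite invr_gt0 mulr_gt0.
have KT : K * T = 2^-1 by rewrite /T invfM mulrCA mulfV ?gt_eqF// mulr1.
pose C y := `|X y| * T.
have C0 y : 0 <= C y by rewrite mulr_ge0// ltW.
have lt_mul (a t : R) : 0 <= a -> `|t| < T -> a * `|t| <= a * T.
  by move=> a0 tT; rewrite ler_wpM2l// ltW.
have T00 : `|0 : R| < T by rewrite normr0.
have est k y t : `|t| < T -> `|ga k.+1 y t - ga k y t| <= C y / 2 ^+ k.
  elim: k t => [|k IH] t tT.
    rewrite -[X in _ - X](ga0 1%N y) divr1.
    have := mean_value_le_centered (fun s _ => dga 0%N y s) (fun s _ => lexx `|X y|) tT T00.
    by move=> /le_trans; apply; rewrite subr0; exact: lt_mul.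
  have bd s : `|s| < T ->
      `|X (ga k.+1 y s) - X (ga k y s)| <= K * (C y / 2 ^+ k).
    by move=> /IH h; apply: (le_trans (X_lipschitz _ _)); rewrite ler_pM2l.
  have := mean_value_le_centered
    (fun s _ => is_derive_sub (dga k.+1 y s) (dga k y s)) bd tT T00.
  rewrite !ga0 subrr !subr0 => /le_trans; apply.
  have Ck : 0 <= C y / 2 ^+ k by rewrite divr_ge0// exprn_ge0.
  have := lt_mul _ _ (mulr_ge0 (ltW K_gt0) Ck) tT.
  rewrite exprS invfM (mulrC K) -(mulrA _ K T) KT; lra.
(* The Lipschitz constant 2 is stable under iteration: 1 + K T * 2 = 2. *)
have lip k y z t : `|t| < T -> `|ga k y t - ga k z t| <= 2 * `|y - z|.
  have n0 := normr_ge0 (y - z).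
  elim: k t => [|k IH] t tT; first by rewrite /ga/=; lra.
  have bd s : `|s| < T -> `|X (ga k y s) - X (ga k z s)| <= K * (2 * `|y - z|).
    by move=> /IH h; apply: (le_trans (X_lipschitz _ _)); rewrite ler_pM2l.
  have := mean_value_le_centered
    (fun s _ => is_derive_sub (dga k y s) (dga k z s)) bd tT T00.
  rewrite !ga0 subr0 => H.
  rewrite -(subrK (y - z) (ga k.+1 y t - ga k.+1 z t)).
  apply: (le_trans (ler_normD _ _)).
  have := lt_mul _ _ (mulr_ge0 (ltW K_gt0) (mulr_ge0 (ler0n _ 2) n0)) tT.
  rewrite (mulrC K) -(mulrA _ K T) KT; move: H; rewrite (mulrC K).
  move: (ga k.+1 y t) (ga k.+1 z t) => u v; lra.
have /choice[psi Hpsi] : forall yt : V * R, exists l, `|yt.2| < T ->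
    forall k, `|l - ga k yt.1 yt.2| <= 2 * C yt.1 / 2 ^+ k.
  move=> [y t]/=; have [tT|] := boolP (`|t| < T); last by exists y.
  by have [l Hl] := geometric_cvg (fun k => est k y t tT); exists l.
pose T1 := (4 * K)^-1.
have T1E : T1 = T / 2 by rewrite /T1 /T -invfM; congr (_^-1); ring.
have T10 : 0 < T1 by rewrite T1E; lra.
have T100 : `|0 : R| < T1 by rewrite normr0.
(* [psi] is controlled only for |t| < T. Freezing time outside [-T1, T1] gives a curve continuous on
   the whole line, as [P] demands, without changing it for |t| <= T1. *)
pose phi t y := psi (y, clamp T1 t).
have clT s : `|clamp T1 s| < T.
  by apply: (le_lt_trans (clamp_norm _ (ltW T10))); rewrite T1E; lra.
have phiE k t y : `|phi t y - ga k y (clamp T1 t)| <= 2 * C y / 2 ^+ k.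
  exact: (Hpsi (y, clamp T1 t) (clT t)).
(* All iterates stay within 4 [C y] of [y], hence have a common Lipschitz constant, which passes to
   the limit. *)
have cphi y : continuous (phi^~ y).
  apply: (@lipschitz_continuous _ _ _ (`|X y| + K * (4 * C y))) => t s.
  apply: (@le_geometric _ _ _ (2 * C y)) => k.
  have st : `|ga k.+1 y (clamp T1 t) - ga k.+1 y (clamp T1 s)| <=
      (`|X y| + K * (4 * C y)) * `|clamp T1 t - clamp T1 s|.
    apply: (mean_value_le_centered (fun s _ => dga k y s)) (clT t) (clT s) => u uT.
    have -> : X (ga k y u) = X y + (X (ga k y u) - X y) by rewrite subrKC.
    rewrite (le_trans (ler_normD _ _))// lerD2l (le_trans (X_lipschitz _ _))//.
    rewrite ler_pM2l//.
    have h0 := Hpsi (y, u) uT 0%N; have hk := Hpsi (y, u) uT k.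
    rewrite /= divr1 in h0; rewrite /= in hk.
    have : 2 * C y / 2 ^+ k <= 2 * C y.
      rewrite ler_pdivrMr ?exprn_gt0//; apply: ler_peMr; first by rewrite mulr_ge0.
      by rewrite exprn_ege1// ler1n.
    rewrite -(subrKA (psi (y, u))) => h; rewrite (le_trans (ler_normD _ _))//.
    by move: h0 hk; rewrite (distrC (ga k y u)) /ga/=; lra.
  have := phiE k.+1 t y; have := phiE k.+1 s y.
  have M0 : 0 <= `|X y| + K * (4 * C y).
    by apply: addr_ge0 => //; do 2?apply: mulr_ge0 => //; exact: ltW.
  have := ler_wpM2l M0 (clamp_lipschitz t s (ltW T10)).
  rewrite exprS invfM; move=> h1 h2 h3.
  rewrite (_ : phi t y - phi s y = (phi t y - ga k.+1 y (clamp T1 t)) +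
    (ga k.+1 y (clamp T1 t) - ga k.+1 y (clamp T1 s)) -
    (phi s y - ga k.+1 y (clamp T1 s))); last first.
    by rewrite opprB !subrKA.
  apply: (le_trans (ler_normB _ _)).
  have := ler_normD (phi t y - ga k.+1 y (clamp T1 t))
    (ga k.+1 y (clamp T1 t) - ga k.+1 y (clamp T1 s)); lra.
have phi_int t y : `|t| < T1 -> phi t y = y + P (X \o phi^~ y) t.
  move=> tT1; apply/eqP; rewrite -subr_eq0 -normr_le0.
  apply: (@le_geometric _ _ _ (C y + K * (2 * C y) * T1)) => k.
  have bd s : `|s| < T1 -> `|X (ga k y s) - X (phi s y)| <= K * (2 * C y / 2 ^+ k).
    move=> sT1; apply: (le_trans (X_lipschitz _ _)); rewrite ler_pM2l// distrC.
    by have := phiE k s y; rewrite clamp_id// ltW.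
  have := mean_value_le_centered
    (fun s _ => is_derive_sub (dga k y s) (dP _ y s (cphi y))) bd tT1 T100.
  rewrite ga0 (HP _ (cXo _ (cphi y))).1 addr0 subrr !subr0 => H.
  have := phiE k.+1 t y; rewrite (clamp_id (ltW tT1)) exprS invfM => H1.
  rewrite -(subrKA (ga k.+1 y t)) add0r (le_trans (ler_normD _ _))//.
  have k0 : 0 <= K * (2 * C y / 2 ^+ k).
    apply: mulr_ge0; first exact: ltW.
    by apply: divr_ge0; [exact: mulr_ge0|exact: exprn_ge0].
  have := ler_wpM2l k0 (ltW tT1); lra.
have dphi t y : `|t| < T1 -> is_derive t (1 : R) (phi^~ y) (X (phi t y)).
  move=> tT1; have h := dP _ y t (cphi y); apply: near_eq_is_derive h.
  have tT1' : 0 < T1 - `|t| by rewrite subr_gt0.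
  near=> s; apply/esym/phi_int.
  have : `|t - s| < T1 - `|t| by near: s; exact: nbhsx_ballx.
  by rewrite distrC => h; have := lerB_dist s t; lra.
have phi0 y : phi 0 y = y.
  by rewrite phi_int ?normr0// (HP _ (cXo _ (cphi y))).1 addr0.
exists phi; split => // [t y z tT1|t y tT1].
- rewrite /phi; apply: (@le_geometric _ _ _ (2 * C y + 2 * C z)) => k.
  have := phiE k t y; have := phiE k t z; have := lip k y z _ (clT t).
  rewrite -/(phi t y) -/(phi t z) => h1 h2 h3.
  rewrite (_ : phi t y - phi t z = (phi t y - ga k y (clamp T1 t)) +
    (ga k y (clamp T1 t) - ga k z (clamp T1 t)) -
    (phi t z - ga k z (clamp T1 t))); last first.
    by rewrite opprB !subrKA.
  apply: (le_trans (ler_normB _ _)).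
  have := ler_normD (phi t y - ga k y (clamp T1 t))
    (ga k y (clamp T1 t) - ga k z (clamp T1 t)); lra.
(* The speed is at most |X y| + K (2 C y) = 2 |X y|, again because K T = 1/2. *)
- rewrite -[X in _ - X](phi0 y); have -> : `|t| = `|t - 0| by rewrite subr0.
  apply: (mean_value_le_centered (fun s h => dphi s y h)) tT1 T100 => s sT1.
  have := phiE 0%N s y; rewrite divr1 /ga/= => h.
  have -> : X (phi s y) = X y + (X (phi s y) - X y) by rewrite subrKC.
  rewrite (le_trans (ler_normD _ _))//.
  have := X_lipschitz (phi s y) y.
  have := ler_wpM2l (ltW K_gt0) h.
  have -> : K * (2 * C y) = 2 * `|X y| * (K * T) by rewrite /C; ring.
  rewrite KT; move: (phi s y) => u; lra.
Unshelve. all: by end_near. Qed.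

End Picard.

(** * Local flow of a strictly differentiable field *)

Section LocalFlow.
Context {R : realType} {m : nat}.
Notation V := 'rV[R]_m.
Implicit Types (x y z : V).

(** The norm is the sup norm, so clamping each coordinate is a 1-Lipschitz retraction onto the
    closed ball. *)
Definition box_clamp x0 (r : R) y : V := \row_i (x0 0 i + clamp r (y 0 i - x0 0 i)).

Lemma box_clamp_norm x0 r y : 0 <= r -> `|box_clamp x0 r y - x0| <= r.
Proof.
move=> r0; apply: row_norm_le => // i; rewrite !mxE addrC addKr.
exact: clamp_norm.
Qed.

Lemma box_clamp_id x0 r y : `|y - x0| <= r -> box_clamp x0 r y = y.
Proof.
move=> yr; apply/rowP => i; rewrite mxE clamp_id ?subrKC//.
by have := coord_le_norm (y - x0) i; rewrite !mxE => /le_trans; apply.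
Qed.

Lemma box_clamp_lipschitz x0 r y z : 0 <= r ->
  `|box_clamp x0 r y - box_clamp x0 r z| <= `|y - z|.
Proof.
move=> r0; apply: row_norm_le => // i; rewrite !mxE.
rewrite opprD addrACA subrr add0r (le_trans (clamp_lipschitz _ _ r0))//.
have -> : y 0 i - x0 0 i - (z 0 i - x0 0 i) = (y - z) 0 i by rewrite !mxE; ring.
exact: coord_le_norm.
Qed.

Lemma is_derive_shiftl (c : R -> V) (v : V) (t s : R) :
  is_derive (t + s) (1 : R) c v -> is_derive s (1 : R) (fun s => c (t + s)) v.
Proof.
move=> /is_derive_row dc; apply/is_derive_row => i.
have S : is_derive s (1 : R) (fun s => t + s) 1.
  by apply: (@eq_is_derive _ _ _ (cst t + id)) => //; rewrite add0r.
have h := @is_derive1_comp R (fun s => c s 0 i) _ s _ _ (dc i) S.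
by apply: (eq_is_derive _ h) => //=; rewrite mulr1.
Qed.

Lemma is_derive_scalel (v : V) (s : R) : is_derive s (1 : R) (fun s => s *: v) v.
Proof.
apply/is_derive_row => i.
have := is_deriveZ (v 0 i) (is_derive_id s (1 : R)).
by move=> h; apply: (eq_is_derive _ h) => [u|]; rewrite ?mxE/= [LHS]mulrC ?mul1r.
Qed.

(** Whatever the a priori bound [B], the mean value inequality halves it, since K S <= 1/2;
    iterating sends it to 0. *)
Lemma ode_unique (X : V -> V) (K S B : R) (al be : R -> V) :
  0 <= K -> K * S <= 2^-1 ->
  (forall y z, `|X y - X z| <= K * `|y - z|) ->
  (forall s, `|s| < S -> is_derive s (1 : R) al (X (al s))) ->
  (forall s, `|s| < S -> is_derive s (1 : R) be (X (be s))) ->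
  (forall s, `|s| < S -> `|al s - be s| <= B) ->
  al 0 = be 0 -> forall s, `|s| < S -> al s = be s.
Proof.
move=> K0 KS XK dal dbe bB E0 s sS.
have S0 : `|0 : R| < S by rewrite normr0 (le_lt_trans _ sS).
have H k t : `|t| < S -> `|al t - be t| <= B / 2 ^+ k.
  elim: k t => [|k IH] t tS; first by rewrite divr1; exact: bB.
  have bd u : `|u| < S -> `|X (al u) - X (be u)| <= K * (B / 2 ^+ k).
    by move=> /IH h; apply: (le_trans (XK _ _)); rewrite ler_wpM2l.
  have := mean_value_le_centered
    (fun u h => is_derive_sub (dal u h) (dbe u h)) bd tS S0.
  rewrite E0 subrr !subr0 => /le_trans; apply.
  have b0 : 0 <= B / 2 ^+ k := le_trans (normr_ge0 _) (IH _ S0).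
  have := ler_wpM2l (mulr_ge0 K0 b0) (ltW tS).
  have := ler_wpM2r b0 KS; rewrite exprS invfM; lra.
apply/eqP; rewrite -subr_eq0 -normr_le0; apply: (@le_geometric _ _ _ B) => k.
by rewrite add0r; exact: H.
Qed.

Lemma sdiff_lipschitz {p : nat} (X : V -> 'rV[R]_p) x0 M : sdiff X x0 M ->
  exists2 K, 0 < K & exists2 d, 0 < d & forall y z,
    `|y - x0| < d -> `|z - x0| < d -> `|X y - X z| <= K * `|y - z|.
Proof.
move=> XM; have [K K0 MK] := mulmx_bounded M.
exists (1 + K); first by lra.
have [d d0 Xd] := XM _ ltr01; exists d => // y z yd zd.
rewrite -(subrK ((y - z) *m M) (X y - X z)) (le_trans (ler_normD _ _))//.
by rewrite mulrDl lerD// ?Xd.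
Qed.

(** [phi] is the flow of the field truncated to a box, which is globally Lipschitz and coincides
    with [X] near [x0]; so the inverse clause holds for every [y]. The fourth clause, a first-order
    expansion of the difference of two trajectories with error relative to both |t| and |y - z|,
    stands in for differentiability in the initial point. *)
Lemma local_flow (X : V -> V) x0 M : sdiff X x0 M -> exists phi d,
  [/\ 0 < d /\ (forall y, phi 0 y = y),
      forall t y, `|t| < d -> `|y - x0| < d -> flow X t y (phi t y),
      forall t y, `|t| < d -> phi (- t) (phi t y) = y,
      forall e, 0 < e -> exists2 d', 0 < d' & forall t y z,
        `|t| < d' -> `|y - x0| < d' -> `|z - x0| < d' ->
        `|phi t y - phi t z - (y - z) - t *: ((y - z) *m M)| <= e * `|t| * `|y - z| &
      forall e, 0 < e -> exists2 d', 0 < d' & forall t s y,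
        `|t| < d' -> `|s| < d' -> `|y - x0| < d' ->
        `|phi t y - phi s y - (t - s) *: X x0| <= e * `|t - s|].
Proof.
move=> XM; have [K K0 [d0 d00 XK]] := sdiff_lipschitz XM.
have [KM KM0 MK] := mulmx_bounded M.
pose r := d0 / 2; have r0 : 0 < r by rewrite /r; lra.
have rd0 : r < d0 by rewrite /r; lra.
pose c := box_clamp x0 r.
have cr y : `|c y - x0| <= r by exact/box_clamp_norm/ltW.
pose Y := X \o c.
have YK a b : `|Y a - Y b| <= K * `|a - b|.
  apply: (le_trans (XK _ _ _ _)); try exact: le_lt_trans (cr _) rd0.
  by rewrite ler_pM2l//; exact/box_clamp_lipschitz/ltW.
have YX y : `|y - x0| <= r -> Y y = X y by move=> yr; rewrite /Y/= /c box_clamp_id.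
pose A := `|X x0| + K * r.
have A0 : 0 <= A by rewrite addr_ge0// mulr_ge0// ltW.
have YA y : `|Y y| <= A.
  rewrite -(subrK (X x0) (Y y)) (le_trans (ler_normD _ _))// addrC lerD2l.
  apply: (le_trans (XK _ _ _ _)); first exact: le_lt_trans (cr _) rd0.
    by rewrite subrr normr0.
  by rewrite ler_pM2l.
have [phi [phi0 dphi phi_lip _]] := picard K0 YK.
pose T := (4 * K)^-1; rewrite -/T in dphi phi_lip.
have T0 : 0 < T by rewrite invr_gt0 mulr_gt0.
have KT : K * T = 4^-1 by rewrite /T invfM mulrCA mulfV ?gt_eqF// mulr1.
have T00 : `|0 : R| < T by rewrite normr0.
have phit t s y : `|t| < T -> `|s| < T -> `|phi t y - phi s y| <= A * `|t - s|.
  move=> tT sT.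
  by have := mean_value_le_centered (fun u h => dphi u y h) (fun u _ => YA _) tT sT.
have phiy t y : `|t| < T -> `|phi t y - y| <= A * `|t|.
  by move=> tT; have := phit t 0 y tT T00; rewrite phi0 subr0.
(* Half of [e] is for the initial distance and half for the displacement, at most A |t|; T / 2
   allows two times to be added. *)
pose dr e := Num.min (T / 2) (Num.min (e / 2) (e / (2 * (A + 1)))).
have dr0 e : 0 < e -> 0 < dr e.
  move=> e0; rewrite !lt_min !divr_gt0//= mulr_gt0//; lra.
have drP e t y : 0 < e -> `|t| < dr e -> `|y - x0| < dr e ->
    [/\ `|t| < T, `|y - x0| < e & `|phi t y - x0| < e].
  move=> e0; rewrite !lt_min => /and3P[tT _ tA] /and3P[_ ye _].
  have tT' : `|t| < T by lra.
  split => //; first by lra.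
  rewrite -(subrKA y) (le_lt_trans (ler_normD _ _))//.
  have := phiy t y tT'; move: tA; rewrite ltr_pdivlMr; last by lra.
  have := normr_ge0 t; lra.
have dphiX y t : `|t| < T -> `|phi t y - x0| <= r ->
    is_derive t (1 : R) (phi^~ y) (X (phi t y)).
  by move=> tT /YX <-; exact: dphi.
exists phi, (dr r); split.
- by split => //; exact: dr0.
- move=> t y td yd; exists (- dr r), (dr r), (phi^~ y); split; last by [].
  + by rewrite inE/= in_itv/= oppr_lt0 dr0.
  + by rewrite inE/= in_itv/= -ltr_norml.
  + move=> s; rewrite inE/= in_itv/= -ltr_norml => sd.
    by have [sT _ /ltW] := drP r s y r0 sd yd; exact: dphiX.
  + exact: phi0.
- move=> t y; rewrite !lt_min => /and3P[tT _ _].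
  have dal s : `|s| < T / 2 ->
      is_derive s (1 : R) (fun s => phi (t + s) y) (Y (phi (t + s) y)).
    move=> sT; apply: (@is_derive_shiftl (phi^~ y)); apply: dphi.
    by rewrite (le_lt_trans (ler_normD _ _))//; lra.
  have dbe s : `|s| < T / 2 ->
      is_derive s (1 : R) (phi^~ (phi t y)) (Y (phi s (phi t y))).
    by move=> sT; apply: dphi; lra.
  have tT2 : `|- t| < T / 2 by rewrite normrN.
  have KT2 : K * (T / 2) <= 2^-1 by rewrite mulrA KT; lra.
  have bd s : `|s| < T / 2 ->
      `|phi (t + s) y - phi s (phi t y)| <= 3 * A * T.
    move=> sT.
    have tsT : `|t + s| < T by rewrite (le_lt_trans (ler_normD _ _))//; lra.
    have sT' : `|s| < T by lra.
    have tT' : `|t| < T by lra.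
    have h1 := phiy _ y tsT; have h2 := phiy _ y tT'.
    have h3 := phiy _ (phi t y) sT'.
    rewrite (_ : _ - _ = (phi (t + s) y - y) - (phi t y - y) -
      (phi s (phi t y) - phi t y)); last first.
      move: (phi (t + s) y) (phi t y) (phi s _) => u v w.
      by apply/rowP => i; rewrite !mxE; ring.
    have := ler_normB ((phi (t + s) y - y) - (phi t y - y))
      (phi s (phi t y) - phi t y).
    have := ler_normB (phi (t + s) y - y) (phi t y - y).
    have := ler_wpM2l A0 (ltW tsT); have := ler_wpM2l A0 (ltW sT').
    have := ler_wpM2l A0 (ltW tT'); lra.
  have := ode_unique (ltW K0) KT2 YK dal dbe bd _ tT2.
  by rewrite addr0 subrr !phi0 => /(_ erefl).
- move=> e e0.
  (* The share e / 4 becomes e / 2 because trajectories spread by a factor at most 2. The other e /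
     2 pays for replacing the difference at time s by y - z inside [M], whence e / (4 KM K). *)
  have [d1 d10 Xd1] := XM _ (divr_gt0 e0 (ltr0Sn _ 3)).
  pose q := Num.min d1 r; have q0 : 0 < q by rewrite lt_min d10.
  have eK0 : 0 < e / (4 * (KM * K)) by rewrite divr_gt0// !mulr_gt0.
  pose S := Num.min (dr q) (e / (4 * (KM * K))).
  have SP u : `|u| < S -> `|u| < dr q /\ `|u| < e / (4 * (KM * K)).
    by rewrite lt_min => /andP.
  have SPV (u : V) : `|u| < S -> `|u| < dr q by rewrite lt_min => /andP[].
  have S0 : 0 < S by rewrite lt_min dr0.
  exists S => // t y z tS /SPV yd /SPV zd.
  have n0 := normr_ge0 (y - z).
  have diff s : `|s| < T -> `|phi s y - phi s z - (y - z)| <= 2 * K * `|y - z| * `|s|.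
    move=> sT.
    have bd u : `|u| < T -> `|Y (phi u y) - Y (phi u z)| <= 2 * K * `|y - z|.
      move=> /phi_lip h; apply: (le_trans (YK _ _)).
      by have := ler_wpM2l (ltW K0) (h y z); lra.
    have := mean_value_le_centered
      (fun u h => is_derive_sub (dphi u y h) (dphi u z h)) bd sT T00.
    by rewrite !phi0 subr0.
  pose D s := phi s y - phi s z - s *: ((y - z) *m M).
  pose D' s := Y (phi s y) - Y (phi s z) - (y - z) *m M.
  have dD s : `|s| < S -> is_derive s (1 : R) D (D' s).
    move=> /SP[sd _]; have [sT _ _] := drP _ _ _ q0 sd yd.
    apply: is_derive_sub; last exact: is_derive_scalel.
    by apply: is_derive_sub; exact: dphi.
  have bD s : `|s| < S -> `|D' s| <= e * `|y - z|.
    move=> /SP[sd se].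
    have [sT _ hy] := drP _ _ _ q0 sd yd; have [_ _ hz] := drP _ _ _ q0 sd zd.
    have [hy1 hyr] : `|phi s y - x0| < d1 /\ `|phi s y - x0| <= r.
      by move: hy; rewrite lt_min => /andP[? /ltW].
    have [hz1 hzr] : `|phi s z - x0| < d1 /\ `|phi s z - x0| <= r.
      by move: hz; rewrite lt_min => /andP[? /ltW].
    have h1 := Xd1 _ _ hy1 hz1; rewrite -(YX _ hyr) -(YX _ hzr) in h1.
    have h2 := MK (phi s y - phi s z - (y - z)).
    have h3 := ler_wpM2l (ltW e0) (phi_lip s y z sT).
    have h4 := ler_wpM2l (ltW KM0) (diff s sT).
    have h5 : KM * (2 * K * `|y - z| * `|s|) <= e / 2 * `|y - z|.
      have := ltW se; rewrite ler_pdivlMr ?mulr_gt0// => h.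
      by have := ler_wpM2r n0 h; lra.
    rewrite /D' -(subrKA ((phi s y - phi s z) *m M)) -mulmxBl.
    by apply: (le_trans (ler_normD _ _)); lra.
  have := mean_value_le_centered dD bD tS.
  move=> /(_ 0); rewrite normr0 => /(_ S0); rewrite /D !phi0 scale0r !subr0.
  rewrite addrAC (_ : e * `|t| * `|y - z| = e * `|y - z| * `|t|)//; ring.
- move=> e e0.
  pose q := Num.min (e / K) r; have q0 : 0 < q by rewrite lt_min divr_gt0.
  exists (dr q) => [|t s y td sd yd]; first exact: dr0.
  pose D u := phi u y - u *: X x0.
  pose D' u := Y (phi u y) - X x0.
  have dD u : `|u| < dr q -> is_derive u (1 : R) D (D' u).
    move=> ud; have [uT _ _] := drP _ _ _ q0 ud yd.
    by apply: is_derive_sub; [exact: dphi|exact: is_derive_scalel].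
  have bD u : `|u| < dr q -> `|D' u| <= e.
    move=> ud; have [uT _] := drP _ _ _ q0 ud yd.
    rewrite lt_min => /andP[h1 h2]; rewrite /D' YX; last exact: ltW.
    apply: (le_trans (XK _ _ _ _)); first exact: lt_trans rd0.
      by rewrite subrr normr0.
    by move: h1; rewrite ltr_pdivlMr// mulrC => /ltW.
  have := mean_value_le_centered dD bD td sd.
  rewrite (_ : D t - D s = phi t y - phi s y - (t - s) *: X x0)// /D.
  move: (phi t y) (phi s y) => u v; rewrite scalerBl opprB.
  by apply/rowP => i; rewrite !mxE; ring.
Qed.

End LocalFlow.

(** * Approximate steering *)

Section Orbits.
Context {R : realType} {m : nat} {f g : 'rV[R]_m -> 'rV[R]_m}.
Notation V := 'rV[R]_m.
Implicit Types (x y z v w : V) (e d t s u : R).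
Notation orb := (orbit_through f g).

Lemma orbit_refl x : orb x x.
Proof. by exists [::]. Qed.

Lemma orbit_trans x y z : orb x y -> orb y z -> orb x z.
Proof.
move=> [s1 h1] [s2 h2]; exists (s2 ++ s1).
elim: s2 z h2 => [z /= ->//|[t u] s2 IH z /= [w h2 wz]].
by exists w => //; exact: IH.
Qed.

Lemma flow_rev (X : V -> V) t x y : flow X t x y -> flow X (- t) y x.
Proof.
move=> [a [b [ga [a0 bt dga g0 gt]]]].
exists (a - t), (b - t), (fun s => ga (t + s)).
move: a0 bt; rewrite !inE/= !in_itv/= => /andP[a0 b0] /andP[at_ tb].
split; rewrite ?inE/= ?in_itv/=.
- by apply/andP; split; lra.
- by apply/andP; split; lra.
- move=> s; rewrite inE/= in_itv/= => /andP[ls su].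
  apply: is_derive_shiftl; apply: dga; rewrite inE/= in_itv/=.
  by apply/andP; split; lra.
- by rewrite addr0.
- by rewrite subrr.
Qed.

Lemma orbit_flow u t x y : flow (f + u *: g) t x y -> orb x y.
Proof. by move=> h; exists [:: (t, u)]; exists x. Qed.

Lemma orbit_sym x y : orb x y -> orb y x.
Proof.
move=> [s]; elim: s y => [y /= ->|[t u] s IH y /= [z h zy]]; first exact: orbit_refl.
apply: (@orbit_trans _ z); last exact: IH.
by apply: (@orbit_flow u (- t)); exact: flow_rev.
Qed.

(* [th] moves points near [x] inside their orbits, with velocity [v] up to a
   relative error [e] measured in the Lipschitz (not pointwise) sense. *)
Definition steers x v e := exists (th : R -> V -> V) d,
  [/\ 0 < d,
      forall y, th 0 y = y,
      forall t y, `|t| < d -> `|y - x| < d -> orb y (th t y) &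
      forall t s y z, `|t| < d -> `|s| < d -> `|y - x| < d -> `|z - x| < d ->
        `|th t y - th s z - (y - z) - (t - s) *: v| <=
          e * (`|t - s| + `|y - z|)].

Lemma steers_weaken x v w e e' : 0 <= e' -> `|v - w| <= e' ->
  steers x v e -> steers x w (e + e').
Proof.
move=> e'0 vw [th [d [d0 th0 thorb thv]]]; exists th, d; split => //.
move=> t s y z td sd yd zd; have h := thv t s y z td sd yd zd.
have -> : th t y - th s z - (y - z) - (t - s) *: w =
    (th t y - th s z - (y - z) - (t - s) *: v) + (t - s) *: (v - w).
  by rewrite scalerBr addrA subrK.
rewrite (le_trans (ler_normD _ _))// mulrDl lerD// normrZ.
have n0 := normr_ge0 (t - s); have n1 := normr_ge0 (y - z).
have := ler_wpM2l n0 vw; have := mulr_ge0 e'0 n1; lra.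
Qed.

(** Time is rescaled by [c], but the spatial part of the error is not, so [C] must dominate both 1
    and |c|. With c = 1 / tau this is the division in the difference quotient. *)
Lemma steers_scale x v e c C : 0 <= e -> 1 <= C -> `|c| <= C ->
  steers x v e -> steers x (c *: v) (C * e).
Proof.
move=> e0 C1 cC [th [d [d0 th0 thorb thv]]].
have C0 : 0 < C by lra.
exists (fun t => th (c * t)), (d / C).
have dC t : `|t| < d / C -> `|c * t| < d.
  rewrite ltr_pdivlMr// normrM => h; apply: le_lt_trans h.
  by rewrite mulrC ler_wpM2l.
have dC' : d / C <= d by rewrite ler_pdivrMr//; apply: ler_peMr => //; exact: ltW.
split.
- by rewrite divr_gt0.
- by move=> y; rewrite mulr0.
- by move=> t y td yd; apply: thorb; [exact: dC|exact: lt_le_trans dC'].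
- move=> t s y z td sd yd zd; rewrite scalerA (mulrC _ c) mulrBr.
  apply: (le_trans (thv _ _ _ _ (dC _ td) (dC _ sd) (lt_le_trans yd dC')
    (lt_le_trans zd dC'))).
  rewrite -mulrBr normrM.
  have n0 := normr_ge0 (t - s); have n1 := normr_ge0 (y - z).
  have := ler_wpM2l e0 (ler_wpM2r n0 cC).
  have := ler_wpM2l e0 (ler_wpM2r n1 C1); lra.
Qed.

(** Both motions are run for the same time [t], one after the other. The estimate for [th1] is
    applied to the pair of points displaced by [th2]. *)
Lemma steers_add x v w e1 e2 : 0 <= e1 -> 0 <= e2 ->
  steers x v e1 -> steers x w e2 ->
  steers x (v + w) (e1 * (2 + `|w| + e2) + e2).
Proof.
move=> e10 e20 [th1 [d1 [d10 th10 th1orb th1v]]] [th2 [d2 [d20 th20 th2orb th2v]]].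
(* [th2 t y] is within [D] max(|t|, |y - x|) of [x], so the radius below keeps it in the domain of
   [th1]. *)
pose D := 1 + `|w| + e2.
have w0 := normr_ge0 w; have D1 : 1 <= D by rewrite /D; lra.
have D0 : 0 < 1 + D by lra.
pose d := Num.min d2 (Num.min d1 (d1 / (1 + D))).
have hd u : u < d -> [/\ u < d2, u < d1 & u * (1 + D) < d1].
  by rewrite !lt_min ltr_pdivlMr// => /and3P[].
have near1 t y : `|t| < d -> `|y - x| < d -> `|th2 t y - x| < d1.
  move=> /hd[t2 _ tD] /hd[y2 _ yD].
  have := th2v t 0 y y t2; rewrite normr0 => /(_ d20 y2 y2).
  rewrite th20 subrr subr0 normr0 addr0 subr0 => h.
  rewrite (_ : th2 t y - x = (th2 t y - y - t *: w) + t *: w + (y - x)); last first.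
    by rewrite subrK subrKA.
  have := ler_normD ((th2 t y - y - t *: w) + t *: w) (y - x).
  have := ler_normD (th2 t y - y - t *: w) (t *: w).
  rewrite normrZ => h1 h2.
  have n0 := normr_ge0 t; have n1 := normr_ge0 (y - x).
  have hD : e2 * `|t| + `|t| * `|w| = `|t| * (D - 1) by rewrite /D; ring.
  have D10 : 0 <= D - 1 by lra.
  have [ty|/ltW ty] := leP `|t| `|y - x|.
    by have := ler_wpM2r D10 ty; lra.
  by have := ler_wpM2r D10 ty; lra.
exists (fun t y => th1 t (th2 t y)), d; split.
- by rewrite !lt_min d20 d10 divr_gt0.
- by move=> y; rewrite th20 th10.
- move=> t y td yd; have a1 := near1 _ _ td yd.
  have [t2 t1 _] := hd _ td; have [y2 _ _] := hd _ yd.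
  by apply: (orbit_trans (th2orb _ _ t2 y2)); exact: th1orb.
- move=> t s y z td sd yd zd.
  have [t2 t1 _] := hd _ td; have [s2 s1 _] := hd _ sd.
  have [y2 _ _] := hd _ yd; have [z2 _ _] := hd _ zd.
  have h1 := th1v _ _ _ _ t1 s1 (near1 _ _ td yd) (near1 _ _ sd zd).
  have h2 := th2v _ _ _ _ t2 s2 y2 z2.
  move: (th2 t y) (th2 s z) h1 h2 => a b; move: (th1 t a) (th1 s b) => a' b' h1 h2.
  have -> : a' - b' - (y - z) - (t - s) *: (v + w) =
      (a' - b' - (a - b) - (t - s) *: v) + (a - b - (y - z) - (t - s) *: w).
    by apply/rowP => i; rewrite !mxE; ring.
  have h3 : `|a - b| <= e2 * (`|t - s| + `|y - z|) + `|t - s| * `|w| + `|y - z|.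
    rewrite -[in leLHS](subrK (y - z) (a - b)).
    rewrite -[in leLHS](subrK ((t - s) *: w) (a - b - (y - z))) -normrZ.
    rewrite (le_trans (ler_normD _ _))// lerD2r (le_trans (ler_normD _ _))//.
    by rewrite lerD2r.
  rewrite (le_trans (ler_normD _ _))//.
  have n0 := normr_ge0 (t - s); have n1 := normr_ge0 (y - z).
  have h4 := ler_wpM2l e10 h3.
  have h5 := mulr_ge0 e10 (mulr_ge0 n1 w0).
  have h6 := mulr_ge0 e10 n0; have h7 := mulr_ge0 e10 n1; lra.
Qed.

Definition steerable x v := forall e, 0 < e -> steers x v e.

Lemma steerable_scale x v c : steerable x v -> steerable x (c *: v).
Proof.
move=> xv e e0; pose C := 1 + `|c|.
have C1 : 1 <= C by rewrite /C lerDl.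
have C0 : 0 < C by lra.
have -> : e = C * (e / C) by rewrite mulrC divfK ?gt_eqF.
have eC : 0 < e / C by rewrite divr_gt0.
by apply: steers_scale; [exact: ltW|exact: C1|rewrite /C; lra|exact: xv].
Qed.

Lemma steerable_add x v w : steerable x v -> steerable x w -> steerable x (v + w).
Proof.
move=> xv xw e e0; pose e2 := e / 2; have e20 : 0 < e2 by rewrite /e2; lra.
pose D := 2 + `|w| + e2; have D0 : 0 < D.
  by rewrite /D; have := normr_ge0 w; lra.
have -> : e = e2 / D * D + e2 by rewrite divfK ?gt_eqF// /e2; lra.
have e1 : 0 < e2 / D by rewrite divr_gt0.
by apply: steers_add; [exact: ltW|exact: ltW|exact: xv|exact: xw].
Qed.

Lemma steerable_drift u x M : sdiff (f + u *: g) x M ->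
  steerable x ((f + u *: g) x).
Proof.
move=> XM e e0; have [KM KM0 MK] := mulmx_bounded M.
have [phi [d [[d0 phi0] phi_flow _ phi_sp phi_t]]] := local_flow XM.
have [d1 d10 h1] := phi_sp _ ltr01; have [d2 d20 h2] := phi_t _ e0.
have K1 : 0 < 1 + KM by lra.
(* For |t| (1 + KM) < e, the linear term and the unit-precision remainder of the flow together cost
   at most e |y - z|. *)
exists phi, (Num.min (Num.min d (e / (1 + KM))) (Num.min d1 d2)); split => //.
- by rewrite !lt_min d0 divr_gt0// d10.
- move=> t y; rewrite !lt_min -!andbA => /and4P[td _ _ _] /and4P[yd _ _ _].
  exact: (orbit_flow (phi_flow _ _ td yd)).
- move=> t s y z; rewrite !lt_min -!andbA ltr_pdivlMr//.
  move=> /and4P[_ tK t1 t2] /and4P[_ _ _ s2] /and4P[_ _ y1 _] /and4P[_ _ z1 z2].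
  have {}h1 := h1 _ _ _ t1 y1 z1; have {}h2 := h2 _ _ _ t2 s2 z2.
  have h3 := MK (y - z).
  have n0 := normr_ge0 (t - s); have n1 := normr_ge0 (y - z).
  have h4 : `|t *: ((y - z) *m M)| <= `|t| * (KM * `|y - z|).
    by rewrite normrZ ler_wpM2l.
  move: ((y - z) *m M) h1 h4 => q h1 h4; move: ((f + u *: g) x) h2 => X h2.
  rewrite (_ : _ - _ - _ - _ = (phi t y - phi t z - (y - z) - t *: q) + t *: q +
    (phi t z - phi s z - (t - s) *: X)); last first.
    by apply/rowP => i; rewrite !mxE; ring.
  have := ler_normD ((phi t y - phi t z - (y - z) - t *: q) + t *: q)
    (phi t z - phi s z - (t - s) *: X).
  have := ler_normD (phi t y - phi t z - (y - z) - t *: q) (t *: q).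
  have := ler_wpM2r n1 (ltW tK); lra.
Qed.

End Orbits.

(** * Steering along brackets by conjugation *)

Section Brackets.
Context {R : realType} {m : nat} {f g : 'rV[R]_m -> 'rV[R]_m}.
Notation V := 'rV[R]_m.
Implicit Types (x y z v w : V) (e d t s u : R).
Notation steers := (steers (f := f) (g := g)).
Notation steerable := (steerable (f := f) (g := g)).

Lemma steers_le x v e e' : e <= e' -> steers x v e -> steers x v e'.
Proof.
move=> ee' [th [d [d0 th0 thorb thv]]]; exists th, d; split => //.
move=> t s y z td sd yd zd; apply: (le_trans (thv t s y z td sd yd zd)).
by rewrite ler_wpM2r// addr_ge0.
Qed.

(** [a], [b] are the images of [y], [z] under the flow for time [tau]; [a'], [b'] their steered
    images, with velocity [W] and difference [r] of steering times; [p], [p'] the images of [a'],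
    [b'] under the backward flow; [n] is |y - z|. The constant 10 is 2 + 2 from the two flow
    expansions plus 6 from the steering error, which enters three times with |a - b| <= 2 n. *)
Lemma conjugation_bound (M : 'M[R]_m) (KM tau e ze n r : R)
    (y z a b a' b' p p' W : V) :
  (forall v, `|v *m M| <= KM * `|v|) -> 0 <= tau -> 0 <= e -> tau * KM <= 1 ->
  e * tau <= 1 -> `|W| <= ze -> 0 <= n -> `|a - b| <= 2 * n ->
  `|y - z - (a - b) - (- tau) *: ((a - b) *m M)| <= e * tau * `|a - b| ->
  `|p - p' - (a' - b') - (- tau) *: ((a' - b') *m M)| <= e * tau * `|a' - b'| ->
  `|a' - b' - (a - b) - r *: W| <= e * tau * (`|r| + `|a - b|) ->
  `|p - p' - (y - z) - r *: (W - tau *: (W *m M))| <=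
    (10 + ze) * (e * tau) * (`|r| + n).
Proof.
move=> MK tau0 e0 tauK et1 Wze n0 ab h1 h2 h3.
have et0 : 0 <= e * tau by rewrite mulr_ge0.
move: (e * tau) et1 h1 h2 h3 et0 => q q1 h1 h2 h3 q0.
set E1 := a' - b' - (a - b) - r *: W in h3.
set E2 := p - p' - _ - _ in h2.
set E3 := y - z - _ - _ in h1.
have h4 : `|tau *: (E1 *m M)| <= `|E1|.
  rewrite normrZ ger0_norm//; have := ler_wpM2l tau0 (MK E1).
  by have := ler_wpM2r (normr_ge0 E1) tauK; lra.
have -> : p - p' - (y - z) - r *: (W - tau *: (W *m M)) =
    E2 - E3 + E1 - tau *: (E1 *m M).
  rewrite /E1 !mulmxBl -scalemxAl /E2 /E3 !mulmxBl.
  move: (p' *m M) (W *m M) (a *m M) (b *m M) (a' *m M) (b' *m M).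
  by move=> *; apply/rowP => i; rewrite !mxE; ring.
have h5 : `|a' - b'| <= `|a - b| + `|r| * ze + `|E1|.
  have -> : a' - b' = (a - b) + r *: W + E1.
    by rewrite /E1; apply/rowP => i; rewrite !mxE; ring.
  have := ler_normD (a - b + r *: W) E1; have := ler_normD (a - b) (r *: W).
  rewrite normrZ; have := ler_wpM2l (normr_ge0 r) Wze; lra.
have := ler_normB (E2 - E3 + E1) (tau *: (E1 *m M)).
have := ler_normD (E2 - E3) E1; have := ler_normB E2 E3.
have ze0 := le_trans (normr_ge0 W) Wze.
have r0 := normr_ge0 r; have e10 := normr_ge0 E1.
have k1 := ler_wpM2l q0 h5; have k2 := ler_wpM2l q0 ab.
have k3 := ler_wpM2r e10 q1.
have k4 := mulr_ge0 (mulr_ge0 q0 ze0) n0; have k5 := mulr_ge0 q0 r0.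
lra.
Qed.

Lemma pos_lower_bound (s : seq R) : all (fun b => 0 < b) s ->
  exists2 t, 0 < t & all (fun b => t < b) s.
Proof.
elim: s => [_|b s IH /= /andP[b0 /IH[t t0 ts]]]; first by exists 1.
exists (Num.min t (b / 2)); first by rewrite lt_min t0 divr_gt0.
rewrite gt_min; apply/andP; split; first by apply/orP; right; lra.
by apply: sub_all ts => c tc; rewrite gt_min tc.
Qed.

Lemma triangle_sum v1 v2 v3 v4 :
  `|v1 + v2 + v3 + v4| <= `|v1| + `|v2| + `|v3| + `|v4|.
Proof.
rewrite (le_trans (ler_normD _ _))// lerD2r (le_trans (ler_normD _ _))// lerD2r.
exact: ler_normD.
Qed.

(** The steering maps are phi(-tau) o th_t o phi(tau). The error is [q] [tau] times a constant,
    hence still of order [q] after division by [tau]. *)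
Lemma steers_conjugate x W (phi : R -> V -> V) (M : 'M[R]_m) (KM tau q d ze : R) :
  (forall v, `|v *m M| <= KM * `|v|) -> 0 < KM -> 0 < q -> q <= 1 ->
  0 < tau -> tau * (KM + 1) < 1 -> 0 < d ->
  (forall y, phi (- tau) (phi tau y) = y) ->
  (forall t y, `|t| = tau -> `|y - x| < d -> orbit_through f g y (phi t y)) ->
  (forall t y z, `|t| = tau -> `|y - x| < d -> `|z - x| < d ->
    `|phi t y - phi t z - (y - z) - t *: ((y - z) *m M)| <= q * tau * `|y - z|) ->
  2 * `|phi tau x - x| < d -> `|W| <= ze -> steers (phi tau x) W (q * tau) ->
  steers x (W - tau *: (W *m M)) ((10 + ze) * (q * tau)).
Proof.
move=> MK KM0 q0 q1 tau0 tauK d0 phiK phi_orb sp.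
set x' := phi tau x => xx' Wze [th [dt [dt0 th0 thorb thv]]].
have ze0 : 0 <= ze := le_trans (normr_ge0 W) Wze.
have tauN : `|tau| = tau by rewrite gtr0_norm.
have tauN' : `|- tau| = tau by rewrite normrN.
have xd : `|x - x| < d by rewrite subrr normr0.
have qtau1 : q * tau <= 1 /\ q * tau <= tau /\ tau * KM <= 1.
  clear -q0 q1 tau0 tauK KM0.
  have := ler_wpM2r (ltW tau0) q1; have := mulr_gt0 tau0 KM0; lra.
have [{}qtau1 [qtau tauKM]] := qtau1.
pose D := Num.min (dt / 2) (d / (4 * (ze + 4))).
have zp : 0 < 4 * (ze + 4) by clear -ze0; lra.
have DP (r : R) : 0 <= r -> r < D -> r < dt /\ 2 * r < dt /\ r * ze + 2 * r <= d / 4 /\ 2 * r <= d / 8.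
  move=> r0; rewrite lt_min => /andP[h1]; rewrite ltr_pdivlMr// => h2.
  have := mulr_ge0 r0 ze0; clear -h1 h2 r0; lra.
have D0 : 0 < D by rewrite lt_min !divr_gt0.
have lip y z : `|y - x| < d -> `|z - x| < d ->
    `|phi tau y - phi tau z| <= 2 * `|y - z|.
  move=> yd zd; have h := sp _ _ _ tauN yd zd.
  have h1 := MK (y - z); have h2 := normr_ge0 (y - z).
  have h3 := ler_wpM2l (ltW tau0) h1; have h4 := ler_wpM2r h2 (ltW tauK).
  have h5 := ler_wpM2r h2 qtau.
  have h6 : `|tau *: ((y - z) *m M)| = tau * `|(y - z) *m M|.
    by rewrite normrZ tauN.
  have := triangle_sum (phi tau y - phi tau z - (y - z) - tau *: ((y - z) *m M))
    (tau *: ((y - z) *m M)) (y - z) 0.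
  rewrite addr0 subrK subrK normr0; clear -h h3 h4 h5 h6; lra.
have near_y y : `|y - x| < D ->
    [/\ `|y - x| < d, `|phi tau y - x'| < dt & `|phi tau y - x| < d].
  move=> /(DP _ (normr_ge0 _))[yt [yt2 [ym ym2]]].
  have n1 := normr_ge0 (y - x); have k1 := mulr_ge0 n1 ze0.
  have yd : `|y - x| < d by clear -ym2 n1 d0; lra.
  have h := lip y x yd xd; rewrite -/x' in h.
  split => //; first by clear -h yt2; lra.
  have := ler_normD (phi tau y - x') (x' - x); rewrite subrKA.
  clear -h xx' ym2 d0; lra.
have near_th t y : `|t| < D -> `|y - x| < D -> `|th t (phi tau y) - x| < d.
  move=> /(DP _ (normr_ge0 _))[tt [_ [tm tm2]]] yD.
  have [ym yx' _] := near_y _ yD.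
  have [yt [_ [_ ym2]]] := DP _ (normr_ge0 _) yD.
  have n2 := normr_ge0 t.
  have h := lip y x ym xd; rewrite -/x' in h.
  have h1 := thv t 0 (phi tau y) (phi tau y) tt.
  rewrite normr0 th0 subrr !subr0 normr0 addr0 in h1.
  have {}h1 := h1 dt0 yx' yx'.
  have h2 : `|t *: W| <= `|t| * ze by rewrite normrZ ler_wpM2l.
  have h3 := ler_wpM2r n2 qtau1.
  move: (phi tau y) (th t _) (t *: _) h h1 h2 => a a' w h h1 h2.
  rewrite (_ : a' - x = (a' - a - w) + w + (a - x') + (x' - x)); last first.
    by apply/rowP => i; rewrite !mxE; ring.
  have := triangle_sum (a' - a - w) w (a - x') (x' - x).
  clear -h h1 h2 h3 tm tm2 ym2 xx' n2 d0; lra.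
exists (fun t y => phi (- tau) (th t (phi tau y))), D; split => //.
- by move=> y; rewrite th0 phiK.
- move=> t y tD yD; have [ym yx' ax] := near_y _ yD.
  have [tt _] := DP _ (normr_ge0 _) tD.
  apply: (orbit_trans (phi_orb _ _ tauN ym)).
  by apply: (orbit_trans (thorb _ _ tt yx')); apply: phi_orb => //; exact: near_th.
- move=> t s y z tD sD yD zD.
  have [ym yx' ya] := near_y _ yD; have [zm zx' za] := near_y _ zD.
  have [td _] := DP _ (normr_ge0 _) tD; have [sd _] := DP _ (normr_ge0 _) sD.
  have k1 := sp _ _ _ tauN' ya za.
  have k2 := sp _ _ _ tauN' (near_th _ _ tD yD) (near_th _ _ sD zD).
  have k3 := thv _ _ _ _ td sd yx' zx'.
  rewrite !phiK in k1.
  exact: (conjugation_bound MK (ltW tau0) (ltW q0) tauKM qtau1 Wze (normr_ge0 _)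
    (lip _ _ ym zm) k1 k2 k3).
Qed.

(** For row vectors the target is the value at [x] of the bracket of f + u g with [Z]. It is the
    limit of (W - tau W M - Z x) / tau with W = Z (phi tau x). Here [q] is fixed first, then [tau],
    and only then is [Z] steered at the moved point with precision [q] [tau]. *)
Lemma steerable_bracket u x (Z : V -> V) (M N : 'M[R]_m) :
  sdiff (f + u *: g) x M -> sdiff Z x N -> (forall y, steerable y (Z y)) ->
  steerable x ((f + u *: g) x *m N - Z x *m M).
Proof.
move=> XM ZN HZ e e0; have [KM KM0 MK] := mulmx_bounded M.
have [KN KN0 NK] := mulmx_bounded N.
have [phi [d [[d0 phi0] phi_flow phi_inv phi_sp phi_t]]] := local_flow XM.
set X := f + u *: g in XM phi_t phi_flow *.
pose z0 := `|Z x|; have z00 : 0 <= z0 by exact: normr_ge0.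
pose A := `|X x| + 1; have A0 : 0 < A by rewrite ltr_wpDl.
(* [C1] comes from the conjugation, with |Z x'| <= z0 + 1; [C2] from adding the steering of -Z x.
   [C3] includes the error on the velocity: [A] for the remainder of [Z], [KN] for that of the flow,
   [KM] for replacing Z x' by Z x. *)
pose C1 := 10 + (z0 + 1); pose C2 := C1 * (3 + z0) + 1.
pose C3 := C2 + (A + KN + KM).
have C10 : 0 < C1 by rewrite /C1; clear -z00; lra.
have C20 : 0 < C2.
  by rewrite /C2; have := mulr_ge0 (ltW C10) z00; clear -C10; lra.
have C30 : 0 < C3 by rewrite /C3; clear -C20 A0 KN0 KM0; lra.
have [q [q0 q1 qC]] : exists q, [/\ 0 < q, q <= 1 & q * C3 <= e].
  exists (Num.min 1 (e / C3)); rewrite lt_min divr_gt0 ?ltr01// ge_min lexx.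
  by split => //; rewrite -ler_pdivlMr// ge_min lexx orbT.
have [d1 d10 sp] := phi_sp _ q0; have [d2 d20 pt] := phi_t _ q0.
have [dZ dZ0 hZ] := ZN _ q0.
pose B := (KN + 1) * A; have B0 : 0 < B by rewrite mulr_gt0// addr_gt0.
pose dm := Num.min d d1; have dm0 : 0 < dm by rewrite lt_min d0.
have dmP v : `|v| < dm -> `|v| < d /\ `|v| < d1 by rewrite lt_min => /andP.
(* As |x' - x| <= A tau, the bound dZ / A brings x' into the range of the estimate on [Z], dm / (2
   A) into that of the conjugation, and q / B makes |Z x' - Z x| <= q. *)
have [|tau tau0 /and5P[tau1 taud taud1 tau2 /and5P[tauK tauZ tauA tauB _]]] :=
    @pos_lower_bound [:: 1; d; d1; d2; (KM + 1)^-1; dZ / A; dm / (2 * A); q / B].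
  rewrite /= ltr01 d0 d10 d20 invr_gt0 addr_gt0// (divr_gt0 dZ0 A0).
  by rewrite (divr_gt0 q0 B0) (divr_gt0 dm0) ?mulr_gt0.
have {}tauK : tau * (KM + 1) < 1.
  by move: tauK; rewrite -[X in _ < X -> _]mul1r ltr_pdivlMr// addr_gt0.
rewrite ltr_pdivlMr// in tauZ; rewrite ltr_pdivlMr ?mulr_gt0// in tauA.
rewrite ltr_pdivlMr// in tauB.
have tauN : `|tau| = tau by rewrite gtr0_norm.
pose x' := phi tau x.
have xx (r : R) : 0 < r -> `|x - x| < r by rewrite subrr normr0.
have n0 : `|0 : R| < d2 by rewrite normr0.
have hx' : `|x' - x - tau *: X x| <= q * tau.
  have := pt tau 0 x; rewrite tauN => /(_ tau2 n0 (xx _ d20)).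
  by rewrite phi0 !subr0 tauN.
have qtau : q * tau <= tau by rewrite ler_piMl// ltW.
have xx' : `|x' - x| <= A * tau.
  rewrite -[x' - x](subrK (tau *: X x)) (le_trans (ler_normD _ _))//.
  rewrite normrZ tauN /A; clear -qtau hx'; lra.
have hZx : `|Z x' - Z x - (x' - x) *m N| <= q * (A * tau).
  apply: (le_trans (hZ x' x _ (xx _ dZ0))).
    by rewrite (le_lt_trans xx')// mulrC.
  by rewrite ler_wpM2l// ltW.
have hN : `|(x' - x) *m N - tau *: (X x *m N)| <= KN * (q * tau).
  rewrite scalemxAl -mulmxBl; apply: (le_trans (NK _)).
  by rewrite ler_wpM2l// ltW.
have Zx'x : `|Z x' - Z x| <= q.
  rewrite -[Z x' - Z x](subrK ((x' - x) *m N)) (le_trans (ler_normD _ _))//.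
  have := NK (x' - x); have := ler_wpM2l (ltW KN0) xx'.
  have := ler_wpM2r (mulr_ge0 (ltW A0) (ltW tau0)) q1.
  by move: tauB; rewrite /B; clear -hZx; lra.
have Wz : `|Z x'| <= z0 + 1.
  rewrite -(subrK (Z x) (Z x')) (le_trans (ler_normD _ _))// addrC lerD2l.
  exact: le_trans q1.
have qt0 : 0 < q * tau by rewrite mulr_gt0.
have st1 : steers x (Z x' - tau *: (Z x' *m M)) (C1 * (q * tau)).
  apply: (steers_conjugate MK KM0 q0 q1 tau0 tauK dm0 _ _ _ _ Wz (HZ x' _ qt0)).
  - by move=> y; apply: phi_inv; rewrite tauN.
  - move=> t y tt /dmP[yd _]; apply/orbit_flow/phi_flow => //.
    by rewrite tt.
  - move=> t y z tt /dmP[_ yd] /dmP[_ zd]; have := sp t y z.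
    by rewrite tt; exact.
  - by rewrite -/x'; apply: le_lt_trans tauA; clear -xx'; lra.
have st2 : steers x (- Z x) (q * tau).
  by rewrite -scaleN1r; exact: (steerable_scale (-1) (HZ x)).
have st3 := steers_add (mulr_ge0 (ltW C10) (ltW qt0)) (ltW qt0) st1 st2.
have st4 : steers x (Z x' - tau *: (Z x' *m M) - Z x) (C2 * (q * tau)).
  apply: steers_le st3; rewrite normrN -/z0 /C2.
  have h : q * tau <= 1 by rewrite (le_trans qtau)// ltW.
  have := ler_wpM2l (mulr_ge0 (ltW C10) (ltW qt0)) h; clear; lra.
have tauV : 1 <= tau^-1 by rewrite invf_ge1// ltW.
have C2qt : 0 <= C2 * (q * tau) by rewrite mulr_ge0// ltW.
have tauV' : `|tau^-1| <= tau^-1 by rewrite ger0_norm// invr_ge0 ltW.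
have st5 := steers_scale C2qt tauV tauV' st4.
have E0 : 0 <= q * (A + KN + KM).
  exact: mulr_ge0 (ltW q0) (ltW (addr_gt0 (addr_gt0 A0 KN0) KM0)).
have C2E : tau^-1 * (C2 * (q * tau)) = C2 * q.
  have tau_n0 : tau != 0 by exact: lt0r_neq0.
  by rewrite (mulrCA _ C2) (mulrC q) (mulKf tau_n0).
rewrite C2E in st5.
apply: (steers_le _ (steers_weaken E0 _ st5)).
  by rewrite (mulrC C2) -mulrDr.
have -> : tau^-1 *: (Z x' - tau *: (Z x' *m M) - Z x) - (X x *m N - Z x *m M) =
  tau^-1 *: (Z x' - Z x - (x' - x) *m N) +
  tau^-1 *: ((x' - x) *m N - tau *: (X x *m N)) - (Z x' - Z x) *m M.
  rewrite (mulmxBl (Z x') (Z x)).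
  move: (X x *m N) (Z x' *m M) (Z x *m M) ((x' - x) *m N).
  move=> ? ? ? ?; apply/rowP => i; rewrite !mxE; field; exact: lt0r_neq0.
rewrite (le_trans (ler_normB _ _))// (le_trans (lerD (ler_normD _ _) (lexx _)))//.
rewrite !normrZ (ger0_norm (_ : 0 <= tau^-1)); last by rewrite invr_ge0 ltW.
have k1 : tau^-1 * `|Z x' - Z x - (x' - x) *m N| <= q * A.
  by rewrite ler_pdivrMl// (le_trans hZx)//; clear; lra.
have k2 : tau^-1 * `|(x' - x) *m N - tau *: (X x *m N)| <= KN * q.
  by rewrite ler_pdivrMl// (le_trans hN)//; clear; lra.
have k3 := MK (Z x' - Z x); have k4 := ler_wpM2l (ltW KM0) Zx'x.
clear -k1 k2 k3 k4; lra.
Qed.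

End Brackets.

(** * Openness of orbits and steerability of the Lie algebra *)

Section Controllability.
Context {R : realType} {m : nat} {f g : 'rV[R]_m -> 'rV[R]_m}.
Notation V := 'rV[R]_m.
Implicit Types (x y z v w : V) (e d t s u : R).
Notation steers := (steers (f := f) (g := g)).
Notation steerable := (steerable (f := f) (g := g)).
Notation orb := (orbit_through f g).

Lemma norm_sum_basis (s : seq 'I_m) v :
  `|\sum_(i <- s) v 0 i *: (delta_mx 0 i : V)| <= (size s)%:R * `|v|.
Proof.
have delta1 i : `|(delta_mx 0 i : V)| <= 1.
  by apply: row_norm_le => // j; rewrite mxE; case: (_ && _); rewrite ?normr1 ?normr0.
elim: s => [|i s IH]; first by rewrite big_nil normr0 mul0r.
rewrite big_cons (le_trans (ler_normD _ _))// -[size _]/(size s).+1 -natr1 normrZ.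
have := ler_pM (normr_ge0 _) (normr_ge0 _) (coord_le_norm v i) (delta1 i).
by move: IH; lra.
Qed.

(** The coordinates of [v] serve as times: [G v] starts at [x] and runs the steering motions of the
    listed directions in turn. *)
Lemma steers_basis x (s : seq 'I_m) e :
  (forall i, steerable x (delta_mx 0 i)) -> 0 < e ->
  exists (G : V -> V) d, [/\ 0 < d, G 0 = x,
    forall v, `|v| < d -> orb x (G v) &
    forall v w, `|v| < d -> `|w| < d ->
      `|G v - G w - \sum_(i <- s) (v - w) 0 i *: (delta_mx 0 i : V)| <=
        e * `|v - w|].
Proof.
move=> xs; elim: s e => [|i s IH] e e0.
  exists (fun=> x), 1; split => // [v _|v w _ _]; first exact: orbit_refl.
  by rewrite big_nil !subrr normr0 mulr_ge0// ltW.
pose e2 := e / 2; have e20 : 0 < e2 by rewrite /e2; lra.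
have [G [d1 [d10 G0 Gorb GE]]] := IH _ e20.
pose K := e2 + (size s)%:R; have K0 : 0 < K by rewrite ltr_pwDl// ler0n.
(* The new motion sees a time difference at most |v - w| and a base point difference at most K |v -
   w|. *)
have e10 : 0 < e2 / (1 + K) by rewrite divr_gt0// addr_gt0.
have [th [d2 [d20 th0 thorb thE]]] := xs i _ e10.
have Glip v w : `|v| < d1 -> `|w| < d1 -> `|G v - G w| <= K * `|v - w|.
  move=> vd wd; have := GE v w vd wd; have := norm_sum_basis s (v - w).
  set S := \sum_(_ <- _) _ => h1 h2.
  rewrite -(subrK S (G v - G w)) (le_trans (ler_normD _ _))// /K mulrDl.
  exact: lerD.
pose d := Num.min d1 (Num.min d2 (d2 / K)).
have dP v : `|v| < d -> [/\ `|v| < d1, `|v 0 i| < d2 & `|G v - x| < d2].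
  rewrite !lt_min ltr_pdivlMr// => /and3P[v1 v2 vK]; split => //.
    exact: le_lt_trans (coord_le_norm _ _) v2.
  have := Glip v 0 v1; rewrite normr0 => /(_ d10); rewrite G0 subr0 mulrC => h.
  exact: le_lt_trans vK.
exists (fun v => th (v 0 i) (G v)), d; split.
- by rewrite !lt_min d10 d20 divr_gt0.
- by rewrite mxE th0.
- move=> v /dP[v1 v2 v3]; exact: (orbit_trans (Gorb _ v1) (thorb _ _ v2 v3)).
- move=> v w /dP[v1 v2 v3] /dP[w1 w2 w3].
  have h1 := thE _ _ _ _ v2 w2 v3 w3; have h2 := GE _ _ v1 w1.
  have h3 := Glip _ _ v1 w1; have h4 := coord_le_norm (v - w) i.
  rewrite big_cons; have E : (v - w) 0 i = v 0 i - w 0 i by rewrite !mxE.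
  move: (\sum_(_ <- s) _) h2 => S h2; rewrite E in h4 *.
  move: (th _ _) (th _ _) h1 => b a h1.
  have -> : a - b - ((v 0 i - w 0 i) *: (delta_mx 0 i : V) + S) =
    (a - b - (G v - G w) - (v 0 i - w 0 i) *: (delta_mx 0 i : V)) +
    (G v - G w - S) by apply/rowP => j; rewrite !mxE; ring.
  rewrite (le_trans (ler_normD _ _))//.
  have h5 := ler_wpM2l (ltW e10) (lerD h4 h3).
  have h6 : e2 / (1 + K) * (`|v - w| + K * `|v - w|) = e2 * `|v - w|.
    by field; rewrite gt_eqF// addr_gt0.
  move: h1 h2 h5; rewrite h6 /e2; clear; lra.
Qed.

(* The chord iteration [v |-> v + (y - G v)] contracts, since [G] is
   1/2-close to a translation. *)
Lemma orbit_nbhs x : (forall i, steerable x (delta_mx 0 i)) ->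
  exists2 r, 0 < r & forall y, `|y - x| < r -> orb x y.
Proof.
move=> xs; have half0 : 0 < 2^-1 :> R by lra.
have [G [d [d0 G0 Gorb GE]]] := steers_basis (enum 'I_m) xs half0.
have {}GE v w : `|v| < d -> `|w| < d -> `|G v - G w - (v - w)| <= 2^-1 * `|v - w|.
  move=> vd wd; have := GE v w vd wd.
  by rewrite big_enum/= -row_sum_delta.
exists (d / 2) => [|y yx]; first by lra.
pose u k := iter k (fun v : V => v + (y - G v)) 0.
have uS k : u k.+1 = u k + (y - G (u k)) by [].
pose c := `|y - x|; have c0 : 0 <= c by exact: normr_ge0.
(* The residual halves at each step, and the sum of the steps stays below 2 c < d, so the iterates
   do not leave the domain of [G]. *)
have step k : `|u k| <= 2 * c * (1 - 2^-1 ^+ k) /\ `|y - G (u k)| <= c * 2^-1 ^+ k.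
  elim: k => [|k [IH1 IH2]]; first by rewrite expr0 subrr mulr0 mulr1 normr0 G0.
  have p0 : 0 <= 2^-1 ^+ k :> R by rewrite exprn_ge0// ltW.
  have h1 : `|u k.+1| <= 2 * c * (1 - 2^-1 ^+ k.+1).
    rewrite uS (le_trans (ler_normD _ _))// exprS; clear -IH1 IH2; lra.
  have cp := mulr_ge0 c0 p0.
  have ud : `|u k| < d by clear -IH1 cp yx; rewrite -/c in yx; lra.
  have ud' : `|u k.+1| < d.
    by move: h1; rewrite exprS; clear -cp yx; rewrite -/c in yx; lra.
  split => //; have := GE _ _ ud' ud.
  have -> : u k.+1 - u k = y - G (u k) by rewrite uS addrC addKr.
  have -> : G (u k.+1) - G (u k) - (y - G (u k)) = - (y - G (u k.+1)).
    by apply/rowP => j; rewrite !mxE; ring.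
  by rewrite normrN exprS => /le_trans; apply; clear -IH2; lra.
have ud k : `|u k| <= 2 * c.
  have [h _] := step k; have p0 : 0 <= 2^-1 ^+ k :> R by rewrite exprn_ge0// ltW.
  by have := mulr_ge0 c0 p0; clear -h; lra.
have cd : 2 * c < d by rewrite /c; clear -yx; lra.
have /geometric_cvg[l ul] : forall k, `|u k.+1 - u k| <= c / 2 ^+ k.
  by move=> k; rewrite uS addrC addKr -exprVn; have [] := step k.
have ld : `|l| < d.
  by have := ul 0%N; rewrite divr1 /u/= subr0 => /le_lt_trans; apply.
suff <- : G l = y by exact: Gorb.
apply/eqP; rewrite -subr_eq0 -normr_le0.
apply: (@le_geometric _ _ _ (4 * c)) => k; rewrite add0r.
have [_ h1] := step k; have h2 := GE l (u k) ld (le_lt_trans (ud k) cd).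
have h3 := ul k; rewrite -exprVn in h3 *.
have -> : G l - y = (G l - G (u k) - (l - u k)) + (l - u k) + - (y - G (u k)) + 0.
  by apply/rowP => j; rewrite !mxE; ring.
apply: (le_trans (triangle_sum _ _ _ _)); rewrite normrN normr0.
by clear -h1 h2 h3; lra.
Qed.

(** Orbits are open; since backward times make the orbit relation symmetric, they partition the
    space, so each is also closed. *)
Lemma orbit_setT x : (forall y i, steerable y (delta_mx 0 i)) ->
  orb x = setT.
Proof.
move=> ys; apply/seteqP; split => // y _.
apply: (@normed_clopen_setT R V (orb x) x y); last exact: orbit_refl.
- rewrite openE => z xz; have [r r0 rz] := orbit_nbhs (ys z).
  apply/nbhs_ballP; exists r => // w zw.
  by apply: (orbit_trans xz); apply: rz; rewrite distrC; move: zw; rewrite -ball_normE.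
- rewrite -openC openE => z xz; have [r r0 rz] := orbit_nbhs (ys z).
  apply/nbhs_ballP; exists r => // w zw xw; apply: xz.
  apply: (orbit_trans xw); apply: orbit_sym; apply: rz.
  by rewrite distrC; move: zw; rewrite -ball_normE.
Qed.

Context {F : nat -> R -> R}.
Hypothesis dF : forall k s, is_derive s (1 : R) (F k) (F k.+1 s).
Let sfield := @sfield R m F.

Lemma sfield_sdiff (X : V -> V) x : sfield X -> exists M : 'M[R]_m,
  sdiff X x M /\ forall v i, 'D_v (fun y => X y 0 i) x = (v *m M) 0 i.
Proof.
move=> sX; have [l Hl] := choice (fun i => smooth_sgrad dF x (sX i)).
pose M : 'M[R]_m := \matrix_(i, j) l j i 0.
have ME v i : (v *m M) 0 i = (v *m l i) 0 0.
  by rewrite !mxE; apply: eq_bigr => j _; rewrite !mxE.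
exists M; split => [e e0|v i]; last by rewrite (sgrad_derive _ (Hl i)) ME.
have /choice[d Hd] : forall i, exists d, 0 < d /\ forall y z,
    `|y - x| < d -> `|z - x| < d ->
    `|X y 0 i - X z 0 i - ((y - z) *m l i) 0 0| <= e * `|y - z|.
  by move=> i; have [d d0 Hd] := Hl i e e0; exists d.
have [|r r0 /allP rd] := @pos_lower_bound R [seq d i | i <- enum 'I_m].
  by apply/allP => _ /mapP[i _ ->]; exact: (Hd i).1.
exists r => // y z yr zr; apply: row_norm_le => [|i].
  by rewrite mulr_ge0// ltW.
have ri : r < d i by apply: rd; apply: map_f; rewrite mem_enum.
have subE (v w : V) : (v - w) 0 i = v 0 i - w 0 i by rewrite !mxE.
by rewrite !subE ME; apply: (Hd i).2; exact: lt_trans ri.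
Qed.

Lemma lie_bracket_sdiff (X Y : V -> V) x : sfield X -> sfield Y ->
  exists M N : 'M[R]_m, [/\ sdiff X x M, sdiff Y x N &
    lie_bracket X Y x = X x *m N - Y x *m M].
Proof.
move=> sX sY; have [M [XM DX]] := sfield_sdiff x sX.
have [N [YN DY]] := sfield_sdiff x sY.
exists M, N; split => //; apply/rowP => i.
rewrite [LHS](congr1 (@^~ x) (lie_bracketE dF i sX sY)) /der DX DY.
by move: (X x *m N) (Y x *m M) => ? ?; rewrite !mxE.
Qed.

Hypothesis sf : sfield f.
Hypothesis sg : sfield g.

Definition steerable_field X := sfield X /\ forall y, steerable y (X y).

(* The flows of a Lie field are not part of the dynamics, so brackets with it are
   handled through the Jacobi identity: the fields normalizing the steerable
   fields form a Lie algebra. *)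
Definition steerable_ideal X := steerable_field X /\
  forall Z, steerable_field Z -> steerable_field (lie_bracket X Z).

Lemma steerable_field_lin a X Y : steerable_field X -> steerable_field Y ->
  steerable_field (a *: X + Y).
Proof.
move=> [sX hX] [sY hY]; split.
  apply: sfield_add => //.
  by apply: (@sfield_scale _ _ F (fun=> a)) => //; exact: smooth_cst.
by move=> y; apply: steerable_add => //; exact: steerable_scale.
Qed.

Lemma steerable_field_affine u : steerable_field (f + u *: g).
Proof.
have sX : sfield (f + u *: g).
  apply: sfield_add => //.
  by apply: (@sfield_scale _ _ F (fun=> u)) => //; exact: smooth_cst.
split => // y; have [M [XM _]] := sfield_sdiff y sX.
exact: steerable_drift XM.
Qed.

Lemma steerable_field_affine_bracket u Z : steerable_field Z ->
  steerable_field (lie_bracket (f + u *: g) Z).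
Proof.
move=> [sZ hZ]; have [sX _] := steerable_field_affine u.
split; first exact: sfield_bracket.
move=> y; have [M [N [XM ZN ->]]] := lie_bracket_sdiff y sX sZ.
exact: steerable_bracket.
Qed.

Lemma lie_bracket_lin a X Y Z : sfield X -> sfield Y -> sfield Z ->
  lie_bracket (a *: X + Y) Z = a *: lie_bracket X Z + lie_bracket Y Z.
Proof.
move=> sX sY sZ; have ca : smooth F (fun _ : V => a) by exact: smooth_cst.
have saX : sfield (a *: X) by exact: (sfield_scale ca sX).
rewrite (lie_bracket_addl dF saX sY sZ); congr (_ + _).
rewrite (lie_bracket_scalel dF ca sX sZ) der_cst.
by apply/funext => x; rewrite !fctE scale0r subr0.
Qed.

Lemma steerable_ideal_lin a X Y : steerable_ideal X -> steerable_ideal Y ->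
  steerable_ideal (a *: X + Y).
Proof.
move=> [hX HX] [hY HY]; split; first exact: steerable_field_lin.
move=> Z hZ; rewrite lie_bracket_lin; [|exact: hX.1|exact: hY.1|exact: hZ.1].
by apply: steerable_field_lin; [exact: HX|exact: HY].
Qed.

Lemma steerable_ideal_drift : steerable_ideal f.
Proof.
have -> : f = f + 0 *: g by rewrite scale0r addr0.
split; first exact: steerable_field_affine.
by move=> Z; exact: steerable_field_affine_bracket.
Qed.

(** Only the flows of f + u g are available; [g] is reached as the difference of those for u = 1 and
    u = 0. *)
Lemma steerable_ideal_control : steerable_ideal g.
Proof.
have -> : g = -1 *: f + (f + 1 *: g) by rewrite scaleN1r scale1r addKr.
apply: steerable_ideal_lin; first exact: steerable_ideal_drift.
split; first exact: steerable_field_affine.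
by move=> Z; exact: steerable_field_affine_bracket.
Qed.

Lemma Lie_steerable_ideal : Lie [set f; g] `<=` steerable_ideal.
Proof.
apply: smallest_sub; last first.
  by move=> _ [->|->]; [exact: steerable_ideal_drift|exact: steerable_ideal_control].
split.
- have -> : 0 = -1 *: f + f by rewrite scaleN1r addNr.
  by apply: steerable_ideal_lin; exact: steerable_ideal_drift.
- by move=> a X Y; exact: steerable_ideal_lin.
- move=> X Y [hX HX] [hY HY]; split; first exact: HX.
  move=> Z hZ; rewrite (jacobi dF hX.1 hY.1 hZ.1).
  rewrite [_ - _]addrC -scaleN1r; apply: steerable_field_lin.
    exact/HY/HX.
  exact/HX/HY.
Qed.

(** Supplies the smoothness that the bracket computations for the chain assume of the Lie
    algebra. *)
Lemma Lie_sfield X : Lie [set f; g] X -> sfield X.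
Proof. by move=> /Lie_steerable_ideal[[]]. Qed.

Lemma orbit_bracket_generating : (forall x, bracket_generating_at [set f; g] x) ->
  forall x, orb x = setT.
Proof.
move=> bg x; apply: orbit_setT => y i.
have : [set: V] (delta_mx 0 i) by [].
by rewrite -(bg y) => -[X /Lie_steerable_ideal[[_ hX] _] <-].
Qed.

End Controllability.

Lemma Lie_closed {R : realType} {V : normedModType R} (F : set (V -> V)) :
  lie_closed (Lie F).
Proof.
split.
- by move=> S [[S0 _ _] _].
- by move=> a X Y LX LY S [cS FS]; case: (cS) => _ SD _; apply: SD; [exact: LX|exact: LY].
- by move=> X Y LX LY S [cS FS]; case: (cS) => _ _ SB; apply: SB; [exact: LX|exact: LY].
Qed.

Lemma sub_Lie {R : realType} {V : normedModType R} (F : set (V -> V)) :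
  F `<=` Lie F.
Proof. exact: sub_smallest. Qed.

Theorem theorem4 (R : realType) (n : nat) (hn : (2 <= n)%N) (Phi : R -> R)
    (hPhi_analytic : real_analytic Phi)
    (hPhi_bounded_below : has_lbound (range Phi))
    (hPhi_lim : Phi y @[y --> +oo] --> +oo)
    (hPhi_generic : generic_potential Phi) :
  let f : 'rV[R]_(n + n) -> 'rV[R]_(n + n) := chain_drift Phi in
  let g : 'rV[R]_(n + n) -> 'rV[R]_(n + n) := @chain_control R n in
  (forall x : 'rV[R]_(n + n), bracket_generating_at [set f; g] x) /\
  (forall x : 'rV[R]_(n + n), orbit_through f g x = [set: 'rV[R]_(n + n)]).
Proof.
(* [F 1] is the force function, and genericity concerns the [F j.+2], the derivatives of Phi''. *)
move=> f g; pose F k := derive1n k Phi.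
have dF k s : is_derive s (1 : R) (F k) (F k.+1 s).
  exact: real_analytic_is_derive.
have driftq k : (fun x => f x 0 (lshift n k)) = fun x => x 0 (rshift n k).
  by apply/funext => x; rewrite /f /chain_drift row_mxEl mxE.
have driftp k : (fun x => f x 0 (rshift n k)) =
    fun x => F 1 (x 0 (lshift n (ord_pred k)) - x 0 (lshift n k))
           - F 1 (x 0 (lshift n k) - x 0 (lshift n (ordS k))).
  by apply/funext => x; rewrite /f /chain_drift row_mxEr !mxE.
pose k0 : 'I_n := Ordinal (ltnW hn).
have gE : g = pdir k0.
  apply/funext => x; apply/rowP => i; rewrite /g /chain_control /pdir basisE.
  case: (split_ordP i) => k ->; first by rewrite row_mxEl mxE eq_lrshift.
  by rewrite row_mxEr mxE eq_rshift -val_eqE /=; case: (_ == _).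
have sf := sfield_drift driftq driftp.
have sg : sfield F g by rewrite gE; exact: sfield_cst.
have bg x : bracket_generating_at [set f; g] x.
  apply: (chain_bracket_generating hn dF driftq driftp _ (Lie_closed _) _ _
    (erefl : val k0 = 0%N)).
  - by move=> al be p q albe; exact: generic_jet.
  - by move=> X; exact: Lie_sfield.
  - by apply: sub_Lie; left.
  - by rewrite -gE; apply: sub_Lie; right.
by split => //; exact: (orbit_bracket_generating dF sf sg bg).
Qed.
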